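(* Let $(D,G)$ be a group pair. The dressing action of $G$ on $S=D/G$, equipped with the bivectors $P_S^{\mathfrak h}$ ($\mathfrak h$ an isotropic complement of $\mathfrak g$ in $\mathfrak d$), is quasi-hamiltonian and has the identity map of $D/G$ as a moment map.
   Context: Everything is real, finite-dimensional and smooth; ''bivector'' on a manifold means bivector field. $a\wedge b=a\otimes b-b\otimes a$. Manin pair $(\mathfrak d,\mathfrak g)$: a Lie algebra $\mathfrak d$ of dimension $2n$ with an invariant nondegenerate symmetric bilinear form $(\cdot|\cdot)$ of signature $(n,n)$, and a Lie subalgebra $\mathfrak g\subset\mathfrak d$ that is a maximal isotropic subspace. Group pair $(D,G)$: a connected Lie group $D$ with a bi-invariant scalar product and a connected closed Lie subgroup $G$ whose Lie algebras form a Manin pair $(\mathfrak d,\mathfrak g)$. For an isotropic linear complement $\mathfrak h$, $\mathfrak d=\mathfrak g\oplus\mathfrak h$, $p_{\mathfrak g},p_{\mathfrak h}$ are the projections and $j:\mathfrak g^*\to\mathfrak h$ is the isomorphism with $(j(\xi)|x)=\langle\xi,x\rangle$. $F_{\mathfrak h}(x)(\xi,\eta)=\langle j^{-1}p_{\mathfrak h}[j\xi,j\eta],x\rangle$ defines $F_{\mathfrak h}:\mathfrak g\to\bigwedge^2\mathfrak g$, and $\varphi_{\mathfrak h}(\xi,\eta,\zeta)=\langle\zeta,p_{\mathfrak g}[j\xi,j\eta]\rangle$ defines $\varphi_{\mathfrak h}\in\bigwedge^3\mathfrak g$. With a basis $(e_i)$ of $\mathfrak g$ and dual basis $(\varepsilon^i)$,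 $r_{\mathfrak d}=\sum_i e_i\otimes j(\varepsilon^i)$ and $P_D^{\mathfrak h}=r_{\mathfrak d}^\lambda-r_{\mathfrak d}^\rho$ (left- minus right-invariant tensors). $G_D^{\mathfrak h}$ is $G$ with the restriction of $P_D^{\mathfrak h}$ and with $\varphi_{\mathfrak h}$ (a quasi-Poisson Lie group). If $\mathfrak h'$ is another isotropic complement with isomorphism $j'$, the twist from $\mathfrak h$ to $\mathfrak h'$ is $t=j'-j:\mathfrak g^*\to\mathfrak g$, regarded as $t\in\bigwedge^2\mathfrak g$ via $t(\xi,\eta)=\langle t(\xi),\eta\rangle$. The dressing action is the action of $D$ (and of $G\subset D$) on $S=D/G$ induced by left multiplication. For an action on a manifold $M$, $x_M$ is the vector field $(x_Mf)(m)=\frac{d}{dt}f(\exp(-tx)m)|_{t=0}$, extended multiplicatively to tensors; likewise $X_S$ for $X\in\mathfrak d$. $P_S^{\mathfrak h}=-\sum_i(e_i)_S\otimes(j\varepsilon^i)_S$ is the projection of $P_D^{\mathfrak h}$ to $S$; one has $P_S^{\mathfrak h'}=P_S^{\mathfrak h}-t_S$. $\mathfrak h$ is admissible at $s\in S$ if $\mathfrak h\to T_sS$, $\xi\mapsto\xi_S(s)$, is an isomorphism, and admissible on a subset if admissible at each of its points. Where $\mathfrak h$ is admissible, for $x\in\mathfrak g$ the $1$-form $\hat x_{\mathfrak h}$ is defined by $\langle\hat x_{\mathfrak h},\xi_S\rangle=-(x|\xi)$ for all $\xi\in\mathfrak h$. The action of $G_D^{\mathfrak h}$ on $(M,P_M^{\mathfrak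 h})$ is quasi-Poisson if $\frac12[P_M^{\mathfrak h},P_M^{\mathfrak h}]=(\varphi_{\mathfrak h})_M$ and $\mathcal L_{x_M}P_M^{\mathfrak h}=-F_{\mathfrak h}(x)_M$ for $x\in\mathfrak g$ (Schouten bracket normalized by $\frac12[P,P](df,dg,dh)=\{f,\{g,h\}\}+$cyclic, $\{f,g\}=P(df,dg)$). When $\mathfrak h$ is replaced by $\mathfrak h'$, $P_M^{\mathfrak h}$ is replaced by $P_M^{\mathfrak h'}=P_M^{\mathfrak h}-t_M$. For a bivector $P$, $P^\sharp$ is defined by $\langle P^\sharp\alpha,\beta\rangle=P(\beta,\alpha)$. A moment map for a quasi-Poisson action is a map $\mu:M\to S$, equivariant for the $G$-action on $M$ and the dressing action of $G$ on $S$, such that on any open $\Omega\subset M$, $(P_M^{\mathfrak h})^\sharp(\mu^*\hat x_{\mathfrak h})=x_M$ for all $x\in\mathfrak g$ and any $\mathfrak h$ admissible on $\mu(\Omega)$. A quasi-Poisson action is quasi-hamiltonian if it admits a moment map. *)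

(* Defs.v *)
From HB Require Import structures.
From mathcomp Require Import all_boot all_order all_algebra.
From mathcomp Require Import all_classical all_reals all_analysis.

Set Implicit Arguments.
Unset Strict Implicit.
Unset Printing Implicit Defensive.

Import Order.TTheory GRing.Theory Num.Theory.
Import numFieldNormedType.Exports.

Local Open Scope classical_set_scope.
Local Open Scope ring_scope.

(** * Smooth functions between normed spaces *)

(* [Ck k U f]: f is of class C^k on U.  It is only used for open U and
   finite-dimensional V, where the recursive clause (f is differentiable and all
   its directional derivatives are C^k) is the usual notion of class C^(k+1). *)
Fixpoint Ck (R : realType) (V W : normedModType R) (k : nat) (U : set V)
    (f : V -> W) : Prop :=
  match k with
  | 0%N => forall x, U x -> {for x, continuous f}
  | S k' => (forall x, U x -> differentiable f x) /\
            (forall v, Ck k' U (fun x => 'D_v f x))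
  end.

Definition smooth_on (R : realType) (V W : normedModType R) (U : set V)
    (f : V -> W) : Prop := forall k, Ck k U f.

(** * Manifolds *)

(* A chart with domain [cdom]; [cinv] is the inverse of [cmap], and both maps
   carry junk values outside [cdom] and its image. *)
Record chart (R : realType) (k : nat) (T : topologicalType) := Chart {
  cdom : set T;
  cmap : T -> 'rV[R]_k;
  cinv : 'rV[R]_k -> T;
  cdom_open : open cdom;
  cimg_open : open (cmap @` cdom);
  cmapK : forall x, cdom x -> cinv (cmap x) = x;
  cmap_continuous : forall x, cdom x -> {for x, continuous cmap};
  cinv_continuous :
    forall p, (cmap @` cdom) p -> {for p, continuous cinv}
}.

(* The atlas is indexed by the points, the chart of index m being a chart around
   m; every atlas can be so indexed without changing the smooth structure. *)
Record manifold (R : realType) (k : nat) := Manifold {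
  mpoint :> topologicalType;
  chart_at : mpoint -> chart R k mpoint;
  chart_atP : forall m, cdom (chart_at m) m;
  chart_compat : forall a b,
    smooth_on (cmap (chart_at a) @` (cdom (chart_at a) `&` cdom (chart_at b)))
              (cmap (chart_at b) \o cinv (chart_at a));
  manifold_hausdorff : hausdorff_space mpoint;
  manifold_second_countable : @second_countable mpoint
}.

Definition coord_at (R : realType) (k : nat) (M : manifold R k) (m : M) :
  M -> 'rV[R]_k := cmap (chart_at m).

Definition smooth_fun (R : realType) (k : nat) (M : manifold R k)
    (W : normedModType R) (U : set M) (f : M -> W) : Prop :=
  forall a : M,
    smooth_on (coord_at a @` (cdom (chart_at a) `&` U))
              (f \o cinv (chart_at a)).

Definition smooth_map (R : realType) (k l : nat) (M : manifold R k)
    (N : manifold R l) (U : set M) (F : M -> N) : Prop :=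
  (forall m, U m -> {for m, continuous F}) /\
  (forall (a : M) (b : N),
    smooth_on
      (coord_at a @`
         (cdom (chart_at a) `&` U `&` F @^-1` cdom (chart_at b)))
      (coord_at b \o F \o cinv (chart_at a))).

Definition smooth_curve (R : realType) (k : nat) (M : manifold R k)
    (gamma : R -> M) : Prop :=
  continuous gamma /\
  forall a : M,
    smooth_on ((gamma @^-1` cdom (chart_at a)) : set R^o)
              ((coord_at a \o gamma) : R^o -> 'rV[R]_k).

(* Smoothness of a map of two variables on an open set of the product manifold,
   read in the product charts. *)
Definition smooth_map2 (R : realType) (k l p : nat) (M : manifold R k)
    (N : manifold R l) (Q : manifold R p) (U : set (M * N)%type)
    (F : M -> N -> Q) : Prop :=
  (forall mn, U mn ->
     {for mn, continuous (fun z : (M * N)%type => F z.1 z.2)}) /\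
  (forall (a : M) (b : N) (c : Q),
    smooth_on
      ((fun z : (M * N)%type => (coord_at a z.1, coord_at b z.2)) @`
         [set z | [/\ U z, cdom (chart_at a) z.1, cdom (chart_at b) z.2
                    & cdom (chart_at c) (F z.1 z.2)]])
      (fun y : ('rV[R]_k * 'rV[R]_l)%type =>
         coord_at c (F (cinv (chart_at a) y.1) (cinv (chart_at b) y.2)))).

(** * Tangent and cotangent vectors, vector fields, bivectors *)

(* T_m M is 'rV[R]_k, a vector being given by its components in the chart
   [chart_at m].  [tderiv f m v] is the derivative of f along v \in T_m M. *)
Definition tderiv (R : realType) (k : nat) (M : manifold R k)
    (W : normedModType R) (f : M -> W) (m : M) (v : 'rV[R]_k) : W :=
  'D_v (f \o cinv (chart_at m)) (coord_at m m).

Definition tangent_map (R : realType) (k l : nat) (M : manifold R k)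
    (N : manifold R l) (F : M -> N) (m : M) (v : 'rV[R]_k) : 'rV[R]_l :=
  tderiv (coord_at (F m) \o F) m v.

Definition velocity (R : realType) (k : nat) (M : manifold R k)
    (gamma : R -> M) : 'rV[R]_k :=
  derive1 (fun t : R => coord_at (gamma 0) (gamma t)) 0.

Notation covector R k := 'Hom('rV[R]_k, R^o).

Definition dfun (R : realType) (k : nat) (M : manifold R k) (f : M -> R^o)
    (m : M) : covector R k := linfun (tderiv f m : 'rV[R]_k -> R^o).

Definition cotangent_pullback (R : realType) (k l : nat) (M : manifold R k)
    (N : manifold R l) (F : M -> N) (m : M) (alpha : covector R l) :
    covector R k :=
  linfun ((fun v => alpha (tangent_map F m v)) : 'rV[R]_k -> R^o).

Definition vector_field (R : realType) (k : nat) (M : manifold R k) : Type :=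
  M -> 'rV[R]_k.

Definition vf_apply (R : realType) (k : nat) (M : manifold R k)
    (W : normedModType R) (X : vector_field M) (f : M -> W) : M -> W :=
  fun m => tderiv f m (X m).

(* The components of [X, Y](m) are the values of the derivation XY - YX on the
   coordinate functions of the chart [chart_at m]. *)
Definition vf_bracket (R : realType) (k : nat) (M : manifold R k)
    (X Y : vector_field M) : vector_field M :=
  fun m => vf_apply X (vf_apply Y (coord_at m)) m
         - vf_apply Y (vf_apply X (coord_at m)) m.

Definition tensor2 (R : realType) (k : nat) (M : manifold R k) : Type :=
  M -> covector R k -> covector R k -> R^o.

Definition poisson (R : realType) (k : nat) (M : manifold R k) (P : tensor2 M)
    (f g : M -> R^o) : M -> R^o :=
  fun m => P m (dfun f m) (dfun g m).

Definition bivector (R : realType) (k : nat) (M : manifold R k)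
    (P : tensor2 M) : Prop :=
  [/\ forall m a (alpha alpha' beta : covector R k),
        P m (a *: alpha + alpha') beta = a * P m alpha beta + P m alpha' beta,
      forall m (alpha beta : covector R k), P m alpha beta = - P m beta alpha
    & forall (U : set M) (f g : M -> R^o), open U ->
        smooth_fun U f -> smooth_fun U g -> smooth_fun U (poisson P f g)].

(* P^sharp alpha = v, where <P^sharp alpha, beta> = P(beta, alpha). *)
Definition sharp_eq (R : realType) (k : nat) (M : manifold R k)
    (P : tensor2 M) (m : M) (alpha : covector R k) (v : 'rV[R]_k) : Prop :=
  forall beta : covector R k, beta v = P m beta alpha.

(* 1/2 [P, P](df, dg, dh) *)
Definition half_schouten (R : realType) (k : nat) (M : manifold R k)
    (P : tensor2 M) (f g h : M -> R^o) : M -> R^o :=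
  fun m => poisson P f (poisson P g h) m + poisson P g (poisson P h f) m
         + poisson P h (poisson P f g) m.

(* (L_X P)(df, dg) *)
Definition lie_derivative (R : realType) (k : nat) (M : manifold R k)
    (X : vector_field M) (P : tensor2 M) (f g : M -> R^o) : M -> R^o :=
  fun m => vf_apply X (poisson P f g) m - poisson P (vf_apply X f) g m
         - poisson P f (vf_apply X g) m.

(** * Lie groups *)

Record lie_group (R : realType) (k : nat) := LieGroup {
  lg_manifold :> manifold R k;
  lmul : lg_manifold -> lg_manifold -> lg_manifold;
  lone : lg_manifold;
  linv : lg_manifold -> lg_manifold;
  lmulA : forall a b c, lmul a (lmul b c) = lmul (lmul a b) c;
  lmul1 : forall a, lmul lone a = a;
  lmulV : forall a, lmul (linv a) a = lone;
  lmul_smooth : smooth_map2 setT lmul;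
  linv_smooth : smooth_map setT linv
}.

(* The Lie algebra of D is T_1 D with the bracket of left-invariant fields. *)
Definition left_invariant (R : realType) (k : nat) (D : lie_group R k)
    (x : 'rV[R]_k) : vector_field D :=
  fun a => tangent_map (lmul a) (lone D) x.

Definition lie_bracket (R : realType) (k : nat) (D : lie_group R k)
    (x y : 'rV[R]_k) : 'rV[R]_k :=
  vf_bracket (left_invariant (D := D) x) (left_invariant y) (lone D).

(* The exponential map of D: t |-> exp (t x) is the one-parameter subgroup with
   velocity x at t = 0.  This determines exp, which exists on every Lie group. *)
Definition is_exponential (R : realType) (k : nat) (D : lie_group R k)
    (exp : 'rV[R]_k -> D) : Prop :=
  forall x : 'rV[R]_k,
    [/\ forall s t : R, exp ((s + t) *: x) = lmul (exp (s *: x)) (exp (t *: x)),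
        smooth_curve (fun t : R => exp (t *: x))
      & velocity (fun t : R => exp (t *: x)) = x].

Definition subgroup (R : realType) (k : nat) (D : lie_group R k)
    (G : set D) : Prop :=
  [/\ G (lone D), forall a b, G a -> G b -> G (lmul a b)
    & forall a, G a -> G (linv a)].

Definition bilinear (R : realType) (k : nat)
    (B : 'rV[R]_k -> 'rV[R]_k -> R) : Prop :=
  (forall a x x' y, B (a *: x + x') y = a * B x y + B x' y) /\
  (forall a x y y', B x (a *: y + y') = a * B x y + B x y').

(* A bi-invariant scalar product on D, as a pseudo-Riemannian metric; left
   invariance makes it smooth.  Nondegeneracy is part of [manin_pair]. *)
Definition biinvariant_scalar_product (R : realType) (k : nat)
    (D : lie_group R k) (K : D -> 'rV[R]_k -> 'rV[R]_k -> R) : Prop :=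
  [/\ forall a, bilinear (K a),
      forall a u v, K a u v = K a v u,
      forall a b u v,
        K (lmul a b) (tangent_map (lmul a) b u) (tangent_map (lmul a) b v)
        = K b u v
    & forall a b u v,
        K (lmul b a) (tangent_map (fun c => lmul c a) b u)
          (tangent_map (fun c => lmul c a) b v)
        = K b u v].

(** * Manin pairs *)

Definition lie_algebra_bracket (R : realType) (k : nat)
    (br : 'rV[R]_k -> 'rV[R]_k -> 'rV[R]_k) : Prop :=
  [/\ forall a x x' y, br (a *: x + x') y = a *: br x y + br x' y,
      forall x y, br x y = - br y x
    & forall x y z, br x (br y z) + br y (br z x) + br z (br x y) = 0].

Definition signature_nn (R : realType) (n : nat)
    (B : 'rV[R]_(n + n) -> 'rV[R]_(n + n) -> R) : Prop :=
  exists2 E : 'M[R]_(n + n), E \in unitmx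
    & forall i j, B (row i E) (row j E) =
        (block_mx 1%:M 0 0 (- 1%:M) : 'M[R]_(n + n)) i j.

Definition isotropic (R : realType) (k : nat)
    (B : 'rV[R]_k -> 'rV[R]_k -> R) (V : {vspace 'rV[R]_k}) : Prop :=
  forall x y, x \in V -> y \in V -> B x y = 0.

Definition manin_pair (R : realType) (n : nat)
    (br : 'rV[R]_(n + n) -> 'rV[R]_(n + n) -> 'rV[R]_(n + n))
    (B : 'rV[R]_(n + n) -> 'rV[R]_(n + n) -> R)
    (g : {vspace 'rV[R]_(n + n)}) : Prop :=
  [/\ lie_algebra_bracket br,
      [/\ bilinear B, forall x y, B x y = B y x,
          forall x, (forall y, B x y = 0) -> x = 0
        & forall x y z, B (br x y) z = B x (br y z)],
      signature_nn B,
      forall x y, x \in g -> y \in g -> br x y \in g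
    & isotropic B g /\
      forall V, isotropic B V -> (g <= V)%VS -> V = g].

Definition isotropic_complement (R : realType) (k : nat)
    (B : 'rV[R]_k -> 'rV[R]_k -> R) (g h : {vspace 'rV[R]_k}) : Prop :=
  [/\ isotropic B h, (g :&: h)%VS = 0%VS & (g + h)%VS = fullv].

Notation dual R g := 'Hom(subvs_of g, R^o).

Section ManinData.
Variables (R : realType) (k : nat).
Variables (br : 'rV[R]_k -> 'rV[R]_k -> 'rV[R]_k).
Variables (B : 'rV[R]_k -> 'rV[R]_k -> R) (g : {vspace 'rV[R]_k}).
Implicit Types (h : {vspace 'rV[R]_k}) (xi eta zeta : dual R g).

(* j : g^* -> h *)
Definition jmap h xi : 'rV[R]_k :=
  xget 0 [set y | y \in h /\ forall x : subvs_of g, B y (vsval x) = xi x].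

(* The inverse of j. *)
Definition jinv (y : 'rV[R]_k) : dual R g :=
  linfun ((fun x : subvs_of g => B y (vsval x)) : subvs_of g -> R^o).

Definition proj_g h : 'rV[R]_k -> 'rV[R]_k := daddv_pi g h.
Definition proj_h h : 'rV[R]_k -> 'rV[R]_k := daddv_pi h g.

(* Elements of g (x) g and g (x) g (x) g are multilinear forms on g^*. *)
Definition F_ h (x : subvs_of g) xi eta : R :=
  jinv (proj_h h (br (jmap h xi) (jmap h eta))) x.

Definition phi_ h xi eta zeta : R :=
  zeta (vsproj g (proj_g h (br (jmap h xi) (jmap h eta)))).

(* The twist from h to h'. *)
Definition twist h h' xi eta : R :=
  eta (vsproj g (jmap h' xi - jmap h xi)).

Definition dual_basis (i : 'I_(\dim g)) : dual R g :=
  linfun ((fun x : subvs_of g => coord (vbasis g) i (vsval x))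
          : subvs_of g -> R^o).

End ManinData.

(** * Group pairs *)

(* A closed subgroup is the same thing as a closed (embedded) Lie subgroup; its
   Lie algebra [gp_g] is given by [gp_gP].  [gp_K] is the scalar product on D. *)
Record group_pair (R : realType) (n : nat) := GroupPair {
  gp_D : lie_group R (n + n);
  gp_exp : 'rV[R]_(n + n) -> gp_D;
  gp_K : gp_D -> 'rV[R]_(n + n) -> 'rV[R]_(n + n) -> R;
  gp_G : set gp_D;
  gp_g : {vspace 'rV[R]_(n + n)};
  gp_expP : is_exponential gp_exp;
  gp_D_connected : connected [set: gp_D];
  gp_KP : biinvariant_scalar_product gp_K;
  gp_G_subgroup : subgroup gp_G;
  gp_G_closed : closed gp_G;
  gp_G_connected : connected gp_G;
  gp_gP : forall x, x \in gp_g <-> forall t : R, gp_G (gp_exp (t *: x));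
  gp_manin : manin_pair (@lie_bracket R (n + n) gp_D) (gp_K (lone gp_D)) gp_g
}.

Section GroupPairData.
Variables (R : realType) (n : nat) (DG : group_pair R n).

Local Notation D := (gp_D DG).
Local Notation G := (@gp_G R n DG).
Local Notation g := (gp_g DG).
Local Notation B := (@gp_K R n DG (lone (gp_D DG))).
Local Notation br := (@lie_bracket R (n + n) (gp_D DG)).

Definition complement (h : {vspace 'rV[R]_(n + n)}) : Prop :=
  isotropic_complement B g h.

(** ** Actions *)

Section Action.
Variables (k : nat) (M : manifold R k) (act : D -> M -> M).

(* An action of G on M; the values of [act] outside G are irrelevant.  As G is an
   embedded submanifold of D, smoothness on G x M means that [act] coincides
   near each point of G x M with a smooth map defined on an open set of D x M. *)
Definition smooth_action : Prop :=
  [/\ forall m, act (lone D) m = m,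
      forall a b m, G a -> G b -> act (lmul a b) m = act a (act b m)
    & forall a m, G a ->
        exists (U : set (D * M)%type) (F : D -> M -> M),
          [/\ open U, U (a, m), smooth_map2 U F
            & forall b p, G b -> U (b, p) -> F b p = act b p]].

(* x_M *)
Definition fund_field (x : 'rV[R]_(n + n)) : vector_field M :=
  fun m => velocity (fun t : R => act (@gp_exp R n DG (- t *: x)) m).

(* The transpose T^*_m M -> g^* of x |-> x_M(m). *)
Definition fund_transpose (m : M) (alpha : covector R k) : dual R g :=
  linfun ((fun x : subvs_of g => alpha (fund_field (vsval x) m))
          : subvs_of g -> R^o).

(* t_M for t \in g (x) g, and likewise in degree 3. *)
Definition fund_tensor2 (t : dual R g -> dual R g -> R) : tensor2 M :=
  fun m alpha beta => t (fund_transpose m alpha) (fund_transpose m beta).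

Definition fund_tensor3 (t : dual R g -> dual R g -> dual R g -> R) (m : M)
    (alpha beta gamma : covector R k) : R :=
  t (fund_transpose m alpha) (fund_transpose m beta) (fund_transpose m gamma).

(* P h stands for the bivector P_M^h, for h an isotropic complement of g. *)
Definition quasi_poisson_action
    (P : {vspace 'rV[R]_(n + n)} -> tensor2 M) : Prop :=
  [/\ smooth_action,
      forall h, complement h -> bivector (P h),
      forall h, complement h ->
        forall (U : set M) (f1 f2 f3 : M -> R^o), open U ->
          smooth_fun U f1 -> smooth_fun U f2 -> smooth_fun U f3 ->
          forall m, U m ->
            half_schouten (P h) f1 f2 f3 m =
            fund_tensor3 (phi_ br B h) m
              (dfun f1 m) (dfun f2 m) (dfun f3 m),
      forall h, complement h ->
        forall (x : subvs_of g) (U : set M) (f1 f2 : M -> R^o), open U ->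
          smooth_fun U f1 -> smooth_fun U f2 ->
          forall m, U m ->
            lie_derivative (fund_field (vsval x)) (P h) f1 f2 m =
            - fund_tensor2 (F_ br B h x) m (dfun f1 m) (dfun f2 m)
    & forall h h', complement h -> complement h' ->
        forall m alpha beta,
          P h' m alpha beta =
          P h m alpha beta - fund_tensor2 (twist B h h') m alpha beta].

End Action.

(** ** The homogeneous space D/G *)

(* The manifold D/G with its projection: the unique manifold structure on the
   set of left cosets for which the projection is smooth and has smooth local
   sections. *)
Record quotient_manifold := QuotientManifold {
  qm_S :> manifold R n;
  qm_pi : D -> qm_S;
  qm_pi_surj : forall s, exists a, qm_pi a = s;
  qm_pi_eq : forall a b, qm_pi a = qm_pi b <-> G (lmul (linv a) b);
  qm_pi_smooth : smooth_map setT qm_pi;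
  qm_section : forall s, exists (U : set qm_S) (sigma : qm_S -> D),
    [/\ open U, U s, smooth_map U sigma
      & forall u, U u -> qm_pi (sigma u) = u]
}.

Section Dressing.
Variable S : quotient_manifold.

Definition representative (s : S) : D :=
  xget (lone D) [set a | qm_pi S a = s].

Definition dressing (a : D) (s : S) : S :=
  qm_pi S (lmul a (representative s)).

Definition P_S (h : {vspace 'rV[R]_(n + n)}) : tensor2 S :=
  fun s alpha beta =>
    - \sum_(i < \dim g)
        alpha (fund_field dressing (vbasis g)`_i s) *
        beta (fund_field dressing (jmap B h (dual_basis i)) s).

(* The map h -> T_s S is linear, so that it is an isomorphism when bijective. *)
Definition admissible_at (h : {vspace 'rV[R]_(n + n)}) (s : S) : Prop :=
  set_bij [set xi | xi \in h] [set: 'rV[R]_n]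
    (fun xi => fund_field dressing xi s).

Definition admissible_on (h : {vspace 'rV[R]_(n + n)}) (A : set S) : Prop :=
  forall s, A s -> admissible_at h s.

(* The value at s of the 1-form \hat x_h *)
Definition hat_form (h : {vspace 'rV[R]_(n + n)}) (x : subvs_of g) (s : S) :
    covector R n :=
  xget 0 [set alpha : covector R n |
    forall xi, xi \in h -> alpha (fund_field dressing xi s) = - B (vsval x) xi].

Definition moment_map (k : nat) (M : manifold R k) (act : D -> M -> M)
    (P : {vspace 'rV[R]_(n + n)} -> tensor2 M) (mu : M -> S) : Prop :=
  [/\ smooth_map setT mu,
      forall a m, G a -> mu (act a m) = dressing a (mu m)
    & forall (Omega : set M) (h : {vspace 'rV[R]_(n + n)}),
        open Omega -> complement h -> admissible_on h (mu @` Omega) ->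
        forall (x : subvs_of g) m, Omega m ->
          sharp_eq (P h) m (cotangent_pullback mu m (hat_form h x (mu m)))
            (fund_field act (vsval x) m)].

Definition quasi_hamiltonian (k : nat) (M : manifold R k) (act : D -> M -> M)
    (P : {vspace 'rV[R]_(n + n)} -> tensor2 M) : Prop :=
  quasi_poisson_action act P /\ exists mu : M -> S, moment_map act P mu.

End Dressing.

End GroupPairData.

(* Main.v *)
Require Import Defs.
From HB Require Import structures.
From mathcomp Require Import all_boot all_order all_algebra.
From mathcomp Require Import all_classical all_reals all_analysis.
From mathcomp Require Import ring.

(** The fundamental vector fields of D on S = D/G satisfy [x_S, y_S] = [x, y]_S,
    because left and right multiplications commute.  At s = b G the map x |-> x_S(s)
    kills Ad_b g, which is Lagrangian because Ad_b is an isometry.  Writing a covector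
    pulled back to d as (u|.), (v|.), ... one gets u, v in (Ad_b g)^perp = Ad_b g, hence
    (u|v) = 0, and this is the antisymmetry of P_S.  Since sum_i (u|e_i) j(eps^i) is the
    h-component of u and sum_i (u|j(eps^i)) e_i its g-component, the two quasi-Poisson
    identities, once their second-order terms have been cancelled by differentiating the
    antisymmetry relation, become identities between the components of u, v, w that
    follow from the invariance of the form, and the moment map condition reduces to
    sum_i (x|j(eps^i)) e_i = x for x in g. *)

Set Implicit Arguments.
Unset Strict Implicit.
Unset Printing Implicit Defensive.

Import Order.TTheory GRing.Theory Num.Theory.
Import numFieldNormedType.Exports.

Local Open Scope classical_set_scope.
Local Open Scope ring_scope.

(** * Functions of class C^k on normed spaces *)

Section Differentials.
Variable R : realType.
Implicit Types V W Z : normedModType R.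

(** A tangent vector is a row of components in a chart that changes with the point, so computing in
    charts of S would require a change of chart at every step. The fields x_S are therefore used as
    derivations: x_S f at s is the derivative in the direction -x, at the coordinate of 1, of f
    composed with the orbit map of s. A composite of two such derivations becomes a second
    derivative on a fixed vector space, where the chain rule, the symmetry of second derivatives and
    the group law read in the chart at 1 suffice. The sign in exp(-tx) is what makes x |-> x_S a
    homomorphism and not an anti-homomorphism. The vectors u, v, w that represent the pulled-back
    differentials are chosen separately at each point and cannot be differentiated. Hence Poisson
    brackets are differentiated as sums over the constant vectors e_i and j(eps^i), and u, v, w
    enter only once first derivatives alone remain; they then turn every sum over the basis into a
    projection. *)

Lemma near_eq_differentiable V W (f g : V -> W) (x : V) :
  (\forall y \near x, f y = g y) -> differentiable f x -> differentiable g x.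
Proof.
move=> fg df; pose e := g - f.
have e0 : \forall y \near x, e y = 0.
  by near=> y; rewrite /e /= !fctE (near fg y) ?subrr.
(* The difference [e] vanishes near [x], so the zero map is its differential there. *)
suff de : differentiable e x.
  have -> : g = e + f by rewrite /e subrK.
  exact: differentiableD.
have H : e \o shift x = cst (e x) + (0 : V -> W) +o_ 0 id.
  rewrite (nbhs_singleton e0); apply/eqaddoP => _/posnumP[eps].
  move: e0; rewrite (near_shift 0) subr0 => e0.
  near=> y; rewrite /= !fctE /= /cst !addr0 !subr0.
  rewrite (_ : e (y + x) = 0) ?normr0 ?mulr_ge0//.
  by near: y.
pose L : {linear V -> W} := GRing.null_fun W.
have HL : continuous L by move=> y; exact: cst_continuous.
have dL := diff_unique HL H.
by apply/diff_locallyP; rewrite dL; split.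
Unshelve. all: by end_near. Qed.

Lemma scale_is_bilinear W :
  bilinear_for
    (GRing.Scale.Law.clone _ _ *:%R _) (GRing.Scale.Law.clone _ _ *:%R _)
    (fun (a : R^o) (w : W) => a *: w).
Proof.
split=> [u'|u] a x y /=; first by rewrite scalerDl scalerA.
by rewrite scalerDr !scalerA mulrC.
Qed.

Lemma is_diff_scale V W (k : V -> R^o) (F : V -> W) (x : V) :
  differentiable k x -> differentiable F x ->
  differentiable (fun y => k y *: F y) x /\
  forall v, 'd (fun y => k y *: F y) x v = k x *: 'd F x v + 'd k x v *: F x.
Proof.
move=> dk dF.
pose bM := bilinear_isBilinear.Build R R^o W W _ _ _ (scale_is_bilinear W).
pose b : {bilinear R^o -> W -> W} :=
  HB.pack (fun (a : R^o) (w : W) => a *: w) bM.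
have cb : continuous (fun p : R^o * W => b p.1 p.2) by exact: scale_continuous.
have -> : (fun y => k y *: F y) =
  (fun p : R^o * W => b p.1 p.2) \o (fun y => (k y, F y)) by [].
have dp : differentiable (fun y => (k y, F y)) x by exact: differentiable_pair.
have db := differentiable_bilin (k x, F x) cb.
split; first exact: differentiable_comp.
move=> v; rewrite diff_comp // diff_pair //=.
exact: (congr1 (fun h : R^o * W -> W => h ('d k x v, 'd F x v))
               (diff_bilin (k x, F x) cb)).
Qed.

End Differentials.

Section ClassCk.
Variable R : realType.
Implicit Types V W Z : normedModType R.

(** The hypothesis is a germ condition because it must pass to derivatives: if [f] and [g] agree
    near [x], they agree near every point close to [x], and so do their directional derivatives. *)
Lemma Ck_near_eq V W k (U : set V) (f g : V -> W) :
  (forall x, U x -> \forall y \near x, f y = g y) -> Ck k U f -> Ck k U g.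
Proof.
elim: k f g => [|k IH] f g fg /=.
  move=> cf x Ux; have fgx := fg x Ux.
  have E : f x = g x := nbhs_singleton fgx.
  change (g @ x --> g x); rewrite -E; apply: cvg_trans (cf x Ux).
  apply: near_eq_cvg.
  by apply: filterS fgx => y.
move=> [df dDf]; split=> [x Ux|v].
  exact: near_eq_differentiable (fg x Ux) (df x Ux).
apply: IH (dDf v) => x Ux.
have := nbhs_interior (fg x Ux); apply: filterS => y fgy.
by apply: near_eq_derive; exact: fgy.
Qed.

(** Each clause of [Ck] is a condition at single points of [U] on a function of the whole space, so
    a different set may serve at each point. *)
Lemma Ck_local V W k (U : set V) (f : V -> W) :
  (forall x, U x -> exists U', U' x /\ Ck k U' f) -> Ck k U f.
Proof.
elim: k f => [|k IH] f H /=.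
  by move=> x /H [U' [Ux cf]]; exact: cf.
split=> [x /H [U' [Ux [df _]]]|v]; first exact: df.
by apply: IH => x /H [U' [Ux [_ dDf]]]; exists U'; split=> //; exact: dDf.
Qed.

Lemma Ck_subset V W k (U U' : set V) (f : V -> W) :
  U' `<=` U -> Ck k U f -> Ck k U' f.
Proof. by move=> UU' cf; apply: Ck_local => x /UU' Ux; exists U. Qed.

Lemma Ck_pred V W k (U : set V) (f : V -> W) : Ck k.+1 U f -> Ck k U f.
Proof.
elim: k f => [|k IH] f /=.
  by move=> [df _] x /df /differentiable_continuous.
by move=> [df dDf]; split=> // v; apply: IH; exact: dDf.
Qed.

Lemma Ck_cst V W k (U : set V) (c : W) : Ck k U (fun _ : V => c).
Proof.
elim: k c => [|k IH] c /=; first by move=> x _; exact: cst_continuous.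
split=> [x _|v]; first exact: differentiable_cst.
have -> : (fun x : V => 'D_v (fun _ : V => c) x) = fun=> 0.
  by apply/funext => x; exact: derive_cst.
exact: IH.
Qed.

Section Open.
Variables (V : normedModType R) (U : set V).
Hypothesis oU : open U.

Lemma Ck_eq W k (f g : V -> W) :
  (forall x, U x -> f x = g x) -> Ck k U f -> Ck k U g.
Proof.
move=> fg; apply: Ck_near_eq => x Ux.
by near=> y; apply: fg; near: y; exact: open_nbhs_nbhs.
Unshelve. all: by end_near. Qed.

Lemma CkD W k (f g : V -> W) :
  Ck k U f -> Ck k U g -> Ck k U (fun x => f x + g x).
Proof.
elim: k f g => [|k IH] f g /=.
  by move=> cf cg x Ux; apply: continuousD; [exact: cf|exact: cg].
move=> [df dDf] [dg dDg]; split=> [x Ux|v].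
  by apply: differentiableD; [exact: df|exact: dg].
apply: (Ck_eq _ (IH _ _ (dDf v) (dDg v))) => x Ux.
by rewrite [RHS]deriveD//; apply: diff_derivable; [exact: df|exact: dg].
Qed.

Lemma CkZ W k (c : V -> R^o) (f : V -> W) :
  Ck k U c -> Ck k U f -> Ck k U (fun x => c x *: f x).
Proof.
elim: k c f => [|k IH] c f.
  move=> cc cf x Ux; have cx := cc x Ux; have fx := cf x Ux.
  exact: (@cvgZ _ _ _ _ _ _ _ _ _ cx fx).
(* In the Leibniz rule each factor also occurs undifferentiated, so the induction needs its lower
   class as well. *)
move=> sc sf; have ck := Ck_pred sc; have fk := Ck_pred sf.
case: sc => dc dDc; case: sf => df dDf; split=> [x Ux|v].
  by have [] := is_diff_scale (dc x Ux) (df x Ux).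
apply: (Ck_eq _ (CkD (IH _ _ ck (dDf v)) (IH _ _ (dDc v) fk))) => x Ux.
have dcx := dc x Ux; have dfx := df x Ux.
have [d dE] := is_diff_scale dcx dfx.
by rewrite [RHS]deriveE// dE !deriveE.
Qed.

Lemma Ck_sum W k (I : Type) (r : seq I) (f : I -> V -> W) :
  (forall i, Ck k U (f i)) -> Ck k U (fun x => \sum_(i <- r) f i x).
Proof.
move=> cf; elim: r => [|i r IH].
  by under eq_fun do rewrite big_nil; exact: Ck_cst.
by under eq_fun do rewrite big_cons; exact: CkD.
Qed.

Lemma Ck_postlin W Z k (L : {linear W -> Z}) (f : V -> W) :
  continuous L -> Ck k U f -> Ck k U (fun x => L (f x)).
Proof.
move=> cL; elim: k f => [|k IH] f /=.
  by move=> cf x Ux; apply: continuous_comp; [exact: cf|exact: cL].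
move=> [df dDf]; split=> [x Ux|v].
  by apply: differentiable_comp; [exact: df|exact: linear_differentiable].
apply: (Ck_eq _ (IH _ (dDf v))) => x Ux.
have dfx := df x Ux; have dLx := linear_differentiable (f x) cL.
rewrite [RHS]deriveE; last exact: (differentiable_comp dfx dLx).
by rewrite (diff_comp dfx dLx) /= diff_lin// deriveE.
Qed.

Lemma Ck_pair W Z k (f : V -> W) (g : V -> Z) :
  Ck k U f -> Ck k U g -> Ck k U (fun x => (f x, g x)).
Proof.
elim: k f g => [|k IH] f g /=.
  by move=> cf cg x Ux; apply: cvg_pair; [exact: cf|exact: cg].
move=> [df dDf] [dg dDg]; split=> [x Ux|v].
  by apply: differentiable_pair; [exact: df|exact: dg].
apply: (Ck_eq _ (IH _ _ (dDf v) (dDg v))) => x Ux.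
have dfx := df x Ux; have dgx := dg x Ux.
rewrite [RHS]deriveE; last exact: differentiable_pair.
by rewrite diff_pair// !deriveE.
Qed.

End Open.

Lemma Ck_linear V W k (U : set V) (L : {linear V -> W}) :
  continuous L -> Ck k U L.
Proof.
move=> cL; case: k => [|k] /=; first by move=> x _; exact: cL.
split=> [x _|v]; first exact: linear_differentiable.
have -> : (fun x => 'D_v L x) = fun=> L v; last exact: Ck_cst.
apply/funext => x; rewrite deriveE; last exact: linear_differentiable.
by rewrite diff_lin.
Qed.

(* Finite dimensionality; the spanning family [e] need not be free. *)
Definition finite_coords V : Prop :=
  exists (I : finType) (e : I -> V) (c : I -> {linear V -> R^o}),
    (forall i, continuous (c i)) /\ forall v, v = \sum_i c i v *: e i.

Lemma derive_comp V W Z (f : V -> W) (g : W -> Z) (x v : V) :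
  differentiable f x -> differentiable g (f x) ->
  'D_v (g \o f) x = 'D_('D_v f x) g (f x).
Proof.
move=> df dg; rewrite deriveE; last exact: differentiable_comp.
by rewrite diff_comp//= !deriveE.
Qed.

(** The chain rule differentiates [g] in the direction ['D_v f x], which moves with [x], whereas
    [Ck] controls only derivatives along fixed vectors. Expanding this direction in a finite
    spanning family gives a sum of products to which the induction applies; this is where finite
    dimension enters. *)
Lemma Ck_comp V W Z k (U : set V) (U' : set W) (f : V -> W) (g : W -> Z) :
  finite_coords W -> open U -> (forall x, U x -> U' (f x)) ->
  Ck k U f -> Ck k U' g -> Ck k U (g \o f).
Proof.
move=> [N [e [c [cc ce]]]] oU fU; elim: k f g fU => [|k IH] f g fU.
  by move=> cf cg x Ux; apply: continuous_comp; [exact: cf|exact/cg/fU].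
move=> sf sg; have fk := Ck_pred sf; case: sf => df dDf; case: sg => dg dDg.
split=> [x Ux|v].
  by apply: differentiable_comp; [exact: df|exact/dg/fU].
have H : Ck k U (fun x => \sum_i c i ('D_v f x) *: 'D_(e i) g (f x)).
  apply: Ck_sum => // i; apply: CkZ => //.
    exact: Ck_postlin (cc i) (dDf v).
  exact: (IH f (fun y => 'D_(e i) g y) fU fk (dDg (e i))).
apply: (Ck_eq oU _ H) => x Ux.
have dfx := df x Ux; have dgx := dg _ (fU x Ux).
rewrite derive_comp// (deriveE _ dgx) [in RHS](ce ('D_v f x)) linear_sum.
by apply: eq_bigr => i _; rewrite linearZ (deriveE _ dgx).
Qed.

End ClassCk.

Section FiniteCoords.
Variable R : realType.

Lemma finite_coords_reg : finite_coords R^o.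
Proof.
exists unit, (fun=> 1), (fun=> idfun); split=> [_ v|v]; first exact: cvg_id.
by rewrite big_const card_unit /= addr0 [_ *: _]mulr1.
Qed.

Lemma finite_coords_rV n : finite_coords 'rV[R]_n.
Proof.
have lc (i : 'I_n) : linear (fun v : 'rV[R]_n => v 0 i : R^o).
  by move=> a u v; rewrite !mxE.
pose c i : {linear 'rV[R]_n -> R^o} :=
  HB.pack (fun v : 'rV[R]_n => v 0 i : R^o)
    (GRing.isLinear.Build _ _ _ _ _ (lc i)).
exists 'I_n, (fun i => delta_mx 0 i), c; split=> [i v|v].
  exact: coord_continuous.
exact: row_sum_delta.
Qed.

Lemma finite_coords_prod (V W : normedModType R) :
  finite_coords V -> finite_coords W -> finite_coords (V * W)%type.
Proof.
move=> [I [e [c [cc ce]]]] [J [f [d [dc df]]]].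
have l1 i : linear (fun z : V * W => c i z.1).
  by move=> a u v; rewrite /= linearP.
have l2 j : linear (fun z : V * W => d j z.2).
  by move=> a u v; rewrite /= linearP.
pose L (s : I + J) : {linear (V * W)%type -> R^o} := match s with
  | inl i => HB.pack (fun z : V * W => c i z.1)
               (GRing.isLinear.Build _ _ _ _ _ (l1 i))
  | inr j => HB.pack (fun z : V * W => d j z.2)
               (GRing.isLinear.Build _ _ _ _ _ (l2 j))
  end.
exists (I + J)%type,
  (fun s : I + J => match s with inl i => (e i, 0) | inr j => (0, f j) end), L.
split=> [[i|j] z|[v w]].
- by apply: (@continuous_comp _ _ _ fst (c i)); [exact: cvg_fst|exact: cc].
- by apply: (@continuous_comp _ _ _ snd (d j)); [exact: cvg_snd|exact: dc].
have sum1 (K : finType) (F : K -> V * W) :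
    \sum_k F k = (\sum_k (F k).1, \sum_k (F k).2).
  by rewrite [LHS]surjective_pairing !raddf_sum.
rewrite big_sumType /= sum1 (sum1 J) /= {1}(ce v) {1}(df w).
under [X in (_, X) + _]eq_bigr do rewrite scaler0.
under [X in _ + (X, _)]eq_bigr do rewrite scaler0.
rewrite !big1_eq; set A := \sum_i _; set B := \sum_i _.
change ((A, B) = (A + 0, 0 + B)); by rewrite addr0 add0r.
Qed.

End FiniteCoords.

(** * Symmetry of second derivatives *)

Section Schwarz.
Variable R : realType.
Implicit Types V W Z : normedModType R.

Lemma derive_line V W (g : V -> W) (p u : V) (s : R) :
  differentiable g (p + s *: u) ->
  is_derive (s : R^o) 1 (fun t : R^o => g (p + t *: u)) ('D_u g (p + s *: u)).
Proof.
move=> dg.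
pose l := fun t : R^o => p + t *: u.
have dl : differentiable l s by [].
have El : 'D_1 l s = u.
  rewrite deriveE//; rewrite /l.
  rewrite (_ : (fun t => _) = cst p + (fun t : R^o => t *: u))//.
  by rewrite diffD//= diff_cst diff_val /= add0r scale1r.
apply: DeriveDef; first exact/diff_derivable/(differentiable_comp dl dg).
by rewrite (derive_comp _ dl dg) El.
Qed.

Lemma MVT_line V (g : V -> R^o) (p u : V) (h : R) : 0 < h ->
  (forall s, 0 <= s <= h -> differentiable g (p + s *: u)) ->
  exists2 s, 0 <= s <= h & g (p + h *: u) - g p = h * 'D_u g (p + s *: u).
Proof.
move=> h0 dg.
have dF (s : R) : 0 <= s <= h ->
    is_derive (s : R^o) 1 (fun t : R^o => g (p + t *: u)) ('D_u g (p + s *: u)).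
  by move=> /dg; exact: derive_line.
have [||s] := @MVT _ (fun t : R => g (p + t *: u))
                (fun s => 'D_u g (p + s *: u)) 0 h h0.
- by move=> s; rewrite in_itv /= => /andP[s0 sh]; apply: dF; rewrite !ltW.
- apply: derivable_within_continuous => s; rewrite in_itv /= => sh.
  by have [] := dF s sh.
rewrite in_itv /= => /andP[s0 sh] E; exists s; first by rewrite !ltW.
by move: E; rewrite scale0r addr0 subr0 mulrC.
Qed.

(** The mean value theorem is used twice: along [u] for the increment [g] of [f] by [h *: v], then
    along [v] for ['D_u f]. The second difference on the left is symmetric in [u] and [v], which is
    the source of Schwarz's theorem. *)
Lemma mixed_difference V (f : V -> R^o) (x u v : V) (h : R) : 0 < h ->
  (forall s t, 0 <= s <= h -> 0 <= t <= h ->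
     differentiable f (x + s *: u + t *: v) /\
     differentiable (fun y => 'D_u f y) (x + s *: u + t *: v)) ->
  exists s t, [/\ 0 <= s <= h, 0 <= t <= h &
    f (x + h *: u + h *: v) - f (x + h *: u) - f (x + h *: v) + f x =
    h * h * 'D_v (fun y => 'D_u f y) (x + s *: u + t *: v)].
Proof.
move=> h0 df; have hh : 0 <= h <= h by rewrite (ltW h0) lexx.
have zh : (0 : R) <= (0 : R) <= h by rewrite lexx ltW.
pose shv := fun y : V => y + h *: v.
have dsh y : differentiable shv y by exact: differentiableD.
have Dsh y w : 'D_w shv y = w.
  rewrite deriveD ?derive_id ?derive_cst ?addr0//; exact: derivable_cst.
pose g := fun y => f (y + h *: v) - f y.
have dg s : 0 <= s <= h -> differentiable g (x + s *: u).
  move=> sh; apply: differentiableB.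
    apply: (@differentiable_comp _ _ _ _ shv f) => //.
    by have [] := df s h sh hh.
  by have [] := df s 0 sh zh; rewrite scale0r addr0.
have [s sh Es] := MVT_line h0 dg.
have [t th Et] : exists2 t, 0 <= t <= h &
   'D_u f (x + s *: u + h *: v) - 'D_u f (x + s *: u) =
   h * 'D_v (fun y => 'D_u f y) (x + s *: u + t *: v).
  apply: (@MVT_line V (fun y => 'D_u f y)) => // t th.
  by have [] := df s t sh th.
exists s, t; split=> //; rewrite -mulrA -Et.
have -> : 'D_u f (x + s *: u + h *: v) - 'D_u f (x + s *: u) =
          'D_u g (x + s *: u).
  have d1 : differentiable f (shv (x + s *: u)) by have [] := df s h sh hh.
  have d2 : differentiable f (x + s *: u).
    by have [] := df s 0 sh zh; rewrite scale0r addr0.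
  have D1 := derive_comp u (dsh (x + s *: u)) d1; rewrite Dsh in D1.
  rewrite /g [RHS]deriveB; [by rewrite -D1| |exact: diff_derivable].
  exact/diff_derivable/(differentiable_comp (dsh _) d1).
by rewrite -Es /g opprB addrA addrAC.
Qed.

Lemma schwarz_real V (f : V -> R^o) (x u v : V) (U : set V) :
  open U -> U x -> Ck 2 U f ->
  'D_u (fun y => 'D_v f y) x = 'D_v (fun y => 'D_u f y) x.
Proof.
move=> oU Ux [df dDf].
have c1 : {for x, continuous (fun y => 'D_u (fun y => 'D_v f y) y)}.
  exact: (dDf v).2 u x Ux.
have c2 : {for x, continuous (fun y => 'D_v (fun y => 'D_u f y) y)}.
  exact: (dDf u).2 v x Ux.
set D1 := fun y => 'D_u (fun y => 'D_v f y) y in c1 *.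
set D2 := fun y => 'D_v (fun y => 'D_u f y) y in c2 *.
apply/eqP; rewrite -subr_eq0 -normr_le0; apply/ler_addgt0Pr => e e0.
rewrite add0r; have e2 : 0 < e / 2 by rewrite divr_gt0.
have tri (a b w : R) : `|a - w| < e / 2 -> `|b - w| < e / 2 -> `|a - b| <= e.
  move=> aw bw; rewrite -(subrKA w) (le_trans (ler_normD _ _))//.
  by rewrite [leRHS]splitr lerD// ltW// distrC.
have n0 : nbhs x U by exact: open_nbhs_nbhs.
have /cvgrPdist_lt/(_ _ e2) n1 := c1.
have /cvgrPdist_lt/(_ _ e2) n2 := c2.
have N : nbhs x (setI U (setI (fun y => `|D1 x - D1 y| < e / 2)
                              (fun y => `|D2 x - D2 y| < e / 2))).
  by apply: filterI; [exact: n0|apply: filterI; [exact: n1|exact: n2]].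
have [r r0 Hr] := (nbhs_ballP _ _).1 N.
pose M := `|u| + `|v| + 1.
have M0 : 0 < M by rewrite ltr_wpDl// addr_ge0.
(* With this [h] the parallelogram spanned by [h *: u] and [h *: v] has all its points within r/2 of
   [x]; the summand 1 in [M] only keeps it positive. *)
pose h := r / M / 2; have h0 : 0 < h by rewrite !divr_gt0.
have inb s t : 0 <= s <= h -> 0 <= t <= h -> ball x r (x + s *: u + t *: v).
  move=> /andP[s0 sh] /andP[t0 th]; rewrite -ball_normE /= -addrA opprD.
  rewrite addrA subrr add0r normrN.
  rewrite (le_lt_trans (ler_normD _ _))// !normrZ !ger0_norm//.
  rewrite (@le_lt_trans _ _ (h * M))//.
    rewrite (@le_trans _ _ (h * `|u| + h * `|v|))//.
      by rewrite lerD// ler_wpM2r.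
    by rewrite -mulrDr ler_wpM2l ?(ltW h0)// lerDl.
  rewrite /h mulrAC divfK ?gt_eqF// gtr_pMr// invf_lt1// ltr1n//.
have [s [t [sh th E1]]] := @mixed_difference V f x u v h h0 (fun s t sh th =>
   let: conj Uy _ := Hr _ (inb s t sh th) in
   conj (df _ Uy) ((dDf u).1 _ Uy)).
have inb' s' t' : 0 <= s' <= h -> 0 <= t' <= h ->
    ball x r (x + s' *: v + t' *: u).
  by move=> s'h t'h; rewrite addrAC; exact: inb.
have [s' [t' [sh' th' E2]]] := @mixed_difference V f x v u h h0
   (fun s t sh th =>
   let: conj Uy _ := Hr _ (inb' s t sh th) in
   conj (df _ Uy) ((dDf v).1 _ Uy)).
(* The same second difference is computed in both orders, so the two mixed derivatives agree at two
   possibly different points of the ball; continuity at [x] then bounds their difference at [x] by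
   [e]. *)
have E : D1 (x + s' *: v + t' *: u) = D2 (x + s *: u + t *: v).
  apply: (@mulfI _ (h * h)); first by rewrite mulf_neq0// gt_eqF.
  apply: etrans (esym E2) _; apply: etrans _ E1.
  by rewrite [x + h *: v + h *: u]addrAC; congr (_ + _); exact: addrAC.
have [_ [L1 _]] := Hr _ (inb' _ _ sh' th').
have [_ [_ L2]] := Hr _ (inb _ _ sh th).
by rewrite -E in L2; exact: tri L1 L2.
Qed.

Lemma derive_postlin V W Z (L : {linear W -> Z}) (f : V -> W) (x v : V) :
  continuous L -> differentiable f x ->
  'D_v (fun y => L (f y)) x = L ('D_v f x).
Proof.
move=> cL df; have dL := linear_differentiable (f x) cL.
rewrite (deriveE _ (differentiable_comp df dL)) (diff_comp df dL) /=.
by rewrite diff_lin// deriveE.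
Qed.

Lemma schwarz V W (f : V -> W) (x u v : V) (U : set V) :
  finite_coords W -> open U -> U x -> Ck 2 U f ->
  'D_u (fun y => 'D_v f y) x = 'D_v (fun y => 'D_u f y) x.
Proof.
move=> [I [e [c [cc ce]]]] oU Ux sf; have [df dDf] := sf.
suff H i : c i ('D_u (fun y => 'D_v f y) x) = c i ('D_v (fun y => 'D_u f y) x).
  by rewrite (ce ('D_u _ x)) [RHS]ce; apply: eq_bigr => i _; rewrite H.
(* Continuous coordinate functionals commute with derivatives, which reduces the claim to
   real-valued functions. *)
have K w : \forall y \near x, 'D_w (fun z => c i (f z)) y = c i ('D_w f y).
  near=> y; apply: derive_postlin (cc i) (df y _).
  by near: y; exact: open_nbhs_nbhs.
have A1 := derive_postlin u (cc i) ((dDf v).1 x Ux).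
have A2 := derive_postlin v (cc i) ((dDf u).1 x Ux).
apply: etrans (esym A1) _; apply: etrans _ A2.
rewrite -(near_eq_derive u (K v)) -(near_eq_derive v (K u)).
exact: schwarz_real oU Ux (Ck_postlin oU (cc i) sf).
Unshelve. all: by end_near. Qed.

End Schwarz.

(** * Smooth germs and smooth maps into manifolds *)

Section SmoothNear.
Variable R : realType.
Implicit Types V W Z : normedModType R.

(** One neighbourhood serves all orders, so that smoothness at [x] persists at the nearby points. *)
Definition smooth_near V W (x : V) (f : V -> W) : Prop :=
  exists U, [/\ open U, U x & smooth_on U f].

Lemma smooth_on_near V W (U : set V) (x : V) (f : V -> W) :
  nbhs x U -> smooth_on U f -> smooth_near x f.
Proof.
move=> Ux sf; exists U^°; split; [exact: open_interior|exact: Ux|move=> k].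
exact: Ck_subset (@interior_subset _ _) (sf k).
Qed.

Lemma smooth_near_on V W (U : set V) (f : V -> W) :
  (forall x, U x -> smooth_near x f) -> smooth_on U f.
Proof.
move=> sf k; apply: Ck_local => x /sf [U' [_ Ux sf']].
by exists U'; split=> //; exact: sf'.
Qed.

Lemma smooth_near_near V W (x : V) (f : V -> W) :
  smooth_near x f -> \forall y \near x, smooth_near y f.
Proof.
move=> [U [oU Ux sf]]; near=> y; exists U; split=> //.
by near: y; exact: open_nbhs_nbhs.
Unshelve. all: by end_near. Qed.

Lemma smooth_near_eq V W (x : V) (f g : V -> W) :
  (\forall y \near x, f y = g y) -> smooth_near x f -> smooth_near x g.
Proof.
move=> fg [U [oU Ux sf]]; pose U' := U `&` [set y | f y = g y]^°.
have oU' : open U' by apply: openI => //; exact: open_interior.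
exists U'; split=> // k; apply: (@Ck_eq _ _ _ oU' _ _ f).
  by move=> y [_ fgy]; exact: (interior_subset fgy).
by apply: Ck_subset (sf k) => y [].
Qed.

Lemma smooth_near_common V W Z (x : V) (f : V -> W) (g : V -> Z) :
  smooth_near x f -> smooth_near x g ->
  exists U, [/\ open U, U x, smooth_on U f & smooth_on U g].
Proof.
move=> [U [oU Ux sf]] [U' [oU' U'x sg]]; exists (U `&` U').
split=> //; first exact: openI.
  by move=> k; apply: Ck_subset (sf k) => y [].
by move=> k; apply: Ck_subset (sg k) => y [].
Qed.

Lemma smooth_near_differentiable V W (x : V) (f : V -> W) :
  smooth_near x f -> differentiable f x.
Proof. by move=> [U [_ Ux /(_ 1%N) [df _]]]; exact: df. Qed.

Lemma smooth_near_continuous V W (x : V) (f : V -> W) :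
  smooth_near x f -> {for x, continuous f}.
Proof. by move=> /smooth_near_differentiable/differentiable_continuous. Qed.

Lemma smooth_near_derive V W (x v : V) (f : V -> W) :
  smooth_near x f -> smooth_near x (fun y => 'D_v f y).
Proof.
move=> [U [oU Ux sf]]; exists U; split=> // k.
by have [_ dDf] := sf k.+1; exact: dDf.
Qed.

Lemma smooth_near_cst V W (x : V) (c : W) : smooth_near x (fun _ : V => c).
Proof. by exists setT; split=> //; [exact: openT|move=> k; exact: Ck_cst]. Qed.

Lemma smooth_near_linear V W (x : V) (L : {linear V -> W}) :
  continuous L -> smooth_near x L.
Proof.
move=> cL; exists setT; split=> //; first exact: openT.
by move=> k; exact: Ck_linear.
Qed.

Lemma smooth_near_id V (x : V) : smooth_near x (fun y : V => y).
Proof. by apply: (@smooth_near_linear _ _ x idfun) => y; exact: cvg_id. Qed.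

Lemma smooth_near_fst V W (x : V * W) : smooth_near x (fun y : V * W => y.1).
Proof. by apply: (@smooth_near_linear _ _ x fst) => y; exact: cvg_fst. Qed.

Lemma smooth_near_snd V W (x : V * W) : smooth_near x (fun y : V * W => y.2).
Proof. by apply: (@smooth_near_linear _ _ x snd) => y; exact: cvg_snd. Qed.

Lemma smooth_nearD V W (x : V) (f g : V -> W) :
  smooth_near x f -> smooth_near x g -> smooth_near x (fun y => f y + g y).
Proof.
move=> sf sg; have [U [oU Ux {}sf {}sg]] := smooth_near_common sf sg.
by exists U; split=> // k; exact: CkD.
Qed.

Lemma smooth_nearZ V W (x : V) (c : V -> R^o) (f : V -> W) :
  smooth_near x c -> smooth_near x f -> smooth_near x (fun y => c y *: f y).
Proof.
move=> sf sg; have [U [oU Ux {}sf {}sg]] := smooth_near_common sf sg.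
by exists U; split=> // k; exact: CkZ.
Qed.

Lemma smooth_near_sum V W (x : V) (I : Type) (r : seq I) (f : I -> V -> W) :
  (forall i, smooth_near x (f i)) ->
  smooth_near x (fun y => \sum_(i <- r) f i y).
Proof.
move=> sf; elim: r => [|i r IH].
  by under eq_fun do rewrite big_nil; exact: smooth_near_cst.
by under eq_fun do rewrite big_cons; exact: smooth_nearD.
Qed.

Lemma smooth_near_pair V W Z (x : V) (f : V -> W) (g : V -> Z) :
  smooth_near x f -> smooth_near x g -> smooth_near x (fun y => (f y, g y)).
Proof.
move=> sf sg; have [U [oU Ux {}sf {}sg]] := smooth_near_common sf sg.
by exists U; split=> // k; exact: Ck_pair.
Qed.

Lemma smooth_near_comp V W Z (x : V) (f : V -> W) (g : W -> Z) :
  finite_coords W -> smooth_near x f -> smooth_near (f x) g ->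
  smooth_near x (fun y => g (f y)).
Proof.
move=> fW sf [U' [oU' U'fx sg]].
have cf := smooth_near_continuous sf; have [U [oU Ux {}sf]] := sf.
have N : nbhs x (U `&` f @^-1` U').
  by apply: filterI; [exact: open_nbhs_nbhs|apply: cf; exact: open_nbhs_nbhs].
apply: smooth_on_near (nbhs_interior N) _ => k.
apply: (@Ck_comp _ _ _ _ _ _ U') => //; first exact: open_interior.
  by move=> y /interior_subset [].
by apply: Ck_subset (sf k) => y /interior_subset [].
Qed.

Lemma derive_smooth_comp V W Z (x v : V) (f : V -> W) (g : W -> Z) :
  smooth_near x f -> smooth_near (f x) g ->
  'D_v (fun y => g (f y)) x = 'D_('D_v f x) g (f x).
Proof.
by move=> /smooth_near_differentiable df /smooth_near_differentiable dg;
  exact: derive_comp.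
Qed.

Lemma derive_smoothD V W (x v : V) (f g : V -> W) :
  smooth_near x f -> smooth_near x g ->
  'D_v (fun y => f y + g y) x = 'D_v f x + 'D_v g x.
Proof.
by move=> /smooth_near_differentiable df /smooth_near_differentiable dg;
  rewrite -deriveD//; exact: diff_derivable.
Qed.

Lemma derive_smooth_sum V W (x v : V) (I : Type) (r : seq I) (f : I -> V -> W) :
  (forall i, smooth_near x (f i)) ->
  'D_v (fun y => \sum_(i <- r) f i y) x = \sum_(i <- r) 'D_v (f i) x.
Proof.
move=> sf; elim: r => [|i r IH].
  rewrite big_nil; under eq_fun do rewrite big_nil; exact: derive_cst.
rewrite big_cons -IH; under eq_fun do rewrite big_cons.
by apply: derive_smoothD => //; exact: smooth_near_sum.
Qed.

Lemma derive_smoothZ V W (x v : V) (c : V -> R^o) (f : V -> W) :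
  smooth_near x c -> smooth_near x f ->
  'D_v (fun y => c y *: f y) x = c x *: 'D_v f x + 'D_v c x *: f x.
Proof.
move=> /smooth_near_differentiable dc /smooth_near_differentiable df.
by have [d E] := is_diff_scale dc df; rewrite deriveE// E !deriveE.
Qed.

Lemma derive_linear V W (L : {linear V -> W}) (x v : V) :
  continuous L -> 'D_v L x = L v.
Proof.
by move=> cL; rewrite deriveE ?diff_lin//; exact: linear_differentiable.
Qed.

Lemma derive_smooth_linear V W (x : V) (f : V -> W) (a : R) (u v : V) :
  smooth_near x f -> 'D_(a *: u + v) f x = a *: 'D_u f x + 'D_v f x.
Proof.
by move=> /smooth_near_differentiable df; rewrite !deriveE// linearP.
Qed.

Lemma smooth_schwarz V W (x u v : V) (f : V -> W) :
  finite_coords W -> smooth_near x f ->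
  'D_u (fun y => 'D_v f y) x = 'D_v (fun y => 'D_u f y) x.
Proof. by move=> fW [U [oU Ux sf]]; exact: schwarz fW oU Ux (sf 2%N). Qed.

End SmoothNear.

(** * Manifolds and their maps tested on plots *)

Section Plots.
Variable R : realType.
Implicit Types V W : normedModType R.

Section OneManifold.
Variables (k : nat) (M : manifold R k).
Implicit Types (m a b : M).

Local Notation finV := (@finite_coords_rV R k).

Lemma cmap_nbhs m a (A : set M) : cdom (chart_at a) m -> nbhs m A ->
  nbhs (coord_at a m) (coord_at a @` (cdom (chart_at a) `&` A)).
Proof.
move=> am Am; rewrite /coord_at; set c := chart_at a in am *.
have im : (cmap c @` cdom c) (cmap c m) by exists m.
have N1 : nbhs (cmap c m) (cmap c @` cdom c).
  by apply: open_nbhs_nbhs; split=> //; exact: cimg_open.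
have N2 : nbhs (cmap c m) (cinv c @^-1` A).
  by apply: (cinv_continuous im); rewrite cmapK.
apply: filterS (filterI N1 N2) => p [[q cq <-]] /=; rewrite cmapK// => Aq.
by exists q.
Qed.

Lemma cdom_nbhs m a : cdom (chart_at a) m -> nbhs m (cdom (chart_at a)).
Proof. by move=> am; apply: open_nbhs_nbhs; split=> //; exact: cdom_open. Qed.

Lemma coord_cinv_near m a : cdom (chart_at a) m ->
  \forall p \near coord_at a m, coord_at a (cinv (chart_at a) p) = p.
Proof.
move=> am; have N := cmap_nbhs am (cdom_nbhs am).
by apply: filterS N => p [q [aq _] <-]; rewrite /coord_at cmapK.
Qed.

Lemma near_cinv m a (P : M -> Prop) : cdom (chart_at a) m ->
  (\forall p \near m, P p) ->
  \forall y \near coord_at a m, P (cinv (chart_at a) y).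
Proof.
move=> am mP; have N := cmap_nbhs am mP.
by apply: filterS N => _ [q [aq Pq] <-]; rewrite /coord_at cmapK.
Qed.

Lemma cdom_near V (x : V) (phi : V -> M) a :
  {for x, continuous phi} -> cdom (chart_at a) (phi x) ->
  \forall y \near x, cdom (chart_at a) (phi y).
Proof. by move=> cphi ax; apply: cphi; exact: cdom_nbhs. Qed.

Lemma smooth_chart_change m a b :
  cdom (chart_at a) m -> cdom (chart_at b) m ->
  smooth_near (coord_at a m) (coord_at b \o cinv (chart_at a)).
Proof.
move=> am bm; apply: smooth_on_near (chart_compat a b).
by apply: cmap_nbhs => //; exact: cdom_nbhs.
Qed.

Lemma smooth_coord_change V (x : V) (phi : V -> M) a b :
  {for x, continuous phi} ->
  cdom (chart_at a) (phi x) -> cdom (chart_at b) (phi x) ->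
  smooth_near x (coord_at a \o phi) -> smooth_near x (coord_at b \o phi).
Proof.
move=> cphi ax bx sa.
have sb := smooth_chart_change ax bx.
have H := smooth_near_comp finV sa sb.
apply: (smooth_near_eq _ H).
have := cdom_near cphi ax; apply: filterS => y ay /=.
by rewrite cmapK.
Qed.

(* Smoothness of maps between manifolds is tested on plots, that is on smooth
   germs from normed spaces into the manifold; this avoids product manifolds. *)
Definition plot V (x : V) (phi : V -> M) : Prop :=
  {for x, continuous phi} /\ smooth_near x (coord_at (phi x) \o phi).

Lemma plot_coord V (x : V) (phi : V -> M) a :
  plot x phi -> cdom (chart_at a) (phi x) -> smooth_near x (coord_at a \o phi).
Proof.
move=> [cphi sphi] ax.
by apply: smooth_coord_change sphi => //; exact: chart_atP.
Qed.

Lemma plotI V (x : V) (phi : V -> M) a :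
  {for x, continuous phi} -> cdom (chart_at a) (phi x) ->
  smooth_near x (coord_at a \o phi) -> plot x phi.
Proof.
move=> cphi ax sa; split=> //.
by apply: smooth_coord_change sa => //; exact: chart_atP.
Qed.

Lemma plot_eq V (x : V) (phi psi : V -> M) :
  (\forall y \near x, phi y = psi y) -> plot x phi -> plot x psi.
Proof.
move=> E [cphi sphi]; have Ex : phi x = psi x := nbhs_singleton E.
split.
  change (psi @ x --> psi x); rewrite -Ex; apply: cvg_trans cphi.
  by apply: near_eq_cvg; apply: filterS E => y.
rewrite -Ex; apply: smooth_near_eq sphi; apply: filterS E => y /= Ey.
by rewrite Ey.
Qed.

Lemma plot_comp V W (x : V) (f : V -> W) (phi : W -> M) :
  finite_coords W -> smooth_near x f -> plot (f x) phi ->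
  plot x (fun y => phi (f y)).
Proof.
move=> fW sf [cphi sphi]; split.
  by apply: continuous_comp => //; exact: smooth_near_continuous.
exact: smooth_near_comp sf sphi.
Qed.

Lemma plot_cinv m a :
  cdom (chart_at a) m -> plot (coord_at a m) (cinv (chart_at a)).
Proof.
move=> am; have im : (cmap (chart_at a) @` cdom (chart_at a)) (coord_at a m).
  by exists m.
apply: (@plotI _ _ _ a); [exact: cinv_continuous|by rewrite cmapK|].
apply: smooth_near_eq (smooth_near_id _).
by have := coord_cinv_near am; apply: filterS => p /=.
Qed.

Lemma plot_cst V (x : V) m : plot x (fun _ : V => m).
Proof. by split; [exact: cst_continuous|exact: smooth_near_cst]. Qed.

Definition smooth_at W m (f : M -> W) : Prop :=
  smooth_near (coord_at m m) (f \o cinv (chart_at m)).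

Lemma smooth_at_plot V W (x : V) (phi : V -> M) (f : M -> W) :
  plot x phi -> smooth_at (phi x) f -> smooth_near x (fun y => f (phi y)).
Proof.
move=> [cphi sphi] sf.
apply: (smooth_near_eq _ (smooth_near_comp finV sphi sf)).
have := cdom_near cphi (chart_atP (phi x)); apply: filterS => y ay /=.
by rewrite cmapK.
Qed.

Lemma smooth_at_derive V W (x v : V) (phi : V -> M) (f : M -> W) :
  plot x phi -> smooth_at (phi x) f ->
  'D_v (fun y => f (phi y)) x =
  tderiv f (phi x) ('D_v (coord_at (phi x) \o phi) x).
Proof.
move=> [cphi sphi] sf; rewrite /tderiv.
rewrite -(derive_smooth_comp v sphi sf); apply: near_eq_derive.
have := cdom_near cphi (chart_atP (phi x)); apply: filterS => y ay /=.
by rewrite cmapK.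
Qed.

Lemma smooth_at_eq W m (f g : M -> W) :
  (\forall p \near m, f p = g p) -> smooth_at m f -> smooth_at m g.
Proof.
by move=> fg; apply: smooth_near_eq; exact: (near_cinv (chart_atP m) fg).
Qed.

Lemma tderiv_eq W m (f g : M -> W) v :
  (\forall p \near m, f p = g p) -> tderiv f m v = tderiv g m v.
Proof.
by move=> fg; apply: near_eq_derive; exact: (near_cinv (chart_atP m) fg).
Qed.

(** The inverse chart at [m] is itself a plot, so testing on all plots is enough. *)
Lemma smooth_at_nbhs W m (f : M -> W) :
  (forall V (x : V) (phi : V -> M), phi x = m -> plot x phi ->
     smooth_near x (fun y => f (phi y))) -> smooth_at m f.
Proof.
by move=> H; apply: H; [rewrite cmapK//|apply: plot_cinv]; exact: chart_atP.
Qed.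

Lemma smooth_at_coord m a : cdom (chart_at a) m -> smooth_at m (coord_at a).
Proof. by move=> am; apply: smooth_chart_change => //; exact: chart_atP. Qed.

Lemma smooth_fun_at W (U : set M) (f : M -> W) m :
  nbhs m U -> smooth_fun U f -> smooth_at m f.
Proof.
move=> Um /(_ m) sf; apply: smooth_on_near sf.
by apply: cmap_nbhs => //; exact: chart_atP.
Qed.

Lemma smooth_at_fun W (U : set M) (f : M -> W) :
  (forall m, U m -> smooth_at m f) -> smooth_fun U f.
Proof.
move=> sf a; apply: smooth_near_on => p [m [am Um] <-].
apply: (smooth_at_plot (plot_cinv am)); rewrite cmapK//; exact: sf.
Qed.

Lemma tderiv_coord m v : tderiv (coord_at m) m v = v.
Proof.
rewrite /tderiv (@near_eq_derive _ _ _ _ (fun y => y)); first exact: derive_id.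
by have := coord_cinv_near (chart_atP m); apply: filterS => p /=.
Qed.

End OneManifold.

Lemma plot_smooth_map k l (M : manifold R k) (N : manifold R l) V (x : V)
    (phi : V -> M) (U : set M) (F : M -> N) :
  smooth_map U F -> nbhs (phi x) U -> plot x phi -> plot x (fun y => F (phi y)).
Proof.
move=> [cF sF] Ux pphi; have [cphi sphi] := pphi.
have cFx := cF _ (nbhs_singleton Ux).
split; first exact: continuous_comp.
apply: (smooth_at_plot (f := coord_at (F (phi x)) \o F) pphi).
apply: smooth_on_near (sF (phi x) (F (phi x))).
rewrite -setIA; apply: cmap_nbhs; first exact: chart_atP.
by apply: filterI => //; apply: cFx; apply: cdom_nbhs; exact: chart_atP.
Qed.

Lemma plot_smooth_map2 k l p (M : manifold R k) (N : manifold R l)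
    (Q : manifold R p) V (x : V) (phi : V -> M) (psi : V -> N)
    (F : M -> N -> Q) :
  smooth_map2 setT F -> plot x phi -> plot x psi ->
  plot x (fun y => F (phi y) (psi y)).
Proof.
move=> [cF sF] [cphi sphi] [cpsi spsi].
have cFx := cF (phi x, psi x) I.
set a := phi x in cFx sphi *; set b := psi x in cFx spsi *.
split.
  apply: (@continuous_comp _ _ _ (fun y => (phi y, psi y))
            (fun z => F z.1 z.2)) => //.
  exact: cvg_pair.
pose g (y : 'rV[R]_k * 'rV[R]_l) :=
  coord_at (F a b) (F (cinv (chart_at a) y.1) (cinv (chart_at b) y.2)).
have sg : smooth_near (coord_at a a, coord_at b b) g.
  apply: smooth_on_near (sF a b (F a b)).
  have [[A B] /= [Aa Bb] AB] : nbhs (a, b)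
      [set z | cdom (chart_at (F a b)) (F z.1 z.2)].
    by apply: cFx; apply: cdom_nbhs; exact: chart_atP.
  exists (coord_at a @` (cdom (chart_at a) `&` A),
          coord_at b @` (cdom (chart_at b) `&` B)) => /=.
    by split; apply: cmap_nbhs => //; exact: chart_atP.
  move=> [u v] /= [[m [am Am] <-] [n [bn Bn] <-]].
  by exists (m, n) => //=; split=> //; exact: (AB (m, n)).
have fp := finite_coords_prod (@finite_coords_rV R k) (@finite_coords_rV R l).
apply: (smooth_near_eq _ (smooth_near_comp fp (smooth_near_pair sphi spsi) sg)).
have Na := cdom_near cphi (chart_atP (phi x)).
have Nb := cdom_near cpsi (chart_atP (psi x)).
apply: filterS (filterI Na Nb) => y [ay by_]; rewrite /g /=.
by rewrite !cmapK.
Qed.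

(** On the product of the two model spaces, each projection followed by an inverse chart is a plot;
    applying the hypothesis to this one pair gives smoothness in product charts. *)
Lemma smooth_map2_plot k l p (M : manifold R k) (N : manifold R l)
    (Q : manifold R p) (F : M -> N -> Q) :
  (forall mn, {for mn, continuous (fun z : (M * N)%type => F z.1 z.2)}) ->
  (forall V (x : V) (phi : V -> M) (psi : V -> N),
     plot x phi -> plot x psi -> plot x (fun y => F (phi y) (psi y))) ->
  smooth_map2 setT F.
Proof.
move=> cF H; split=> [mn _|a b c]; first exact: cF.
apply: smooth_near_on => _ [[m n] /= [_ am bn cmn] <-].
have fk := @finite_coords_rV R k; have fl := @finite_coords_rV R l.
have pa := plot_comp fk (smooth_near_fst (coord_at a m, coord_at b n))
                     (plot_cinv am).
have pb := plot_comp fl (smooth_near_snd (coord_at a m, coord_at b n))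
                     (plot_cinv bn).
apply: (plot_coord (H _ _ _ _ pa pb)) => /=.
by rewrite !cmapK.
Qed.

End Plots.

(* Otherwise a failing unification of two derivatives unfolds both to limits. *)
Local Opaque derive.

(** * Partial derivatives and the second-order chain rule *)

Section SecondOrder.
Variable R : realType.
Implicit Types V W Z : normedModType R.

(** Partial derivatives become directional derivatives on the product space, so that the symmetry of
    second derivatives applies to mixed partials. *)
Lemma partial_fst V W Z (Q : V * W -> Z) (y x : V) (z : W) :
  smooth_near (y, z) Q ->
  'D_x (fun y' => Q (y', z)) y = 'D_((x, 0) : V * W) Q (y, z).
Proof.
move=> sQ; pose i := fun y' : V => (y', z).
have si : smooth_near y i.
  by apply: smooth_near_pair; [exact: smooth_near_id|exact: smooth_near_cst].
have Di : 'D_x i y = (x, 0).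
  have d1 := smooth_near_differentiable (smooth_near_id y).
  have d2 := smooth_near_differentiable (smooth_near_cst y z).
  rewrite (deriveE _ (differentiable_pair d1 d2)) (diff_pair d1 d2) /=.
  by rewrite diff_cst diff_val.
by rewrite -Di; exact: (derive_smooth_comp x si sQ).
Qed.

Lemma partial_snd V W Z (Q : V * W -> Z) (y : V) (z x : W) :
  smooth_near (y, z) Q ->
  'D_x (fun z' => Q (y, z')) z = 'D_((0, x) : V * W) Q (y, z).
Proof.
move=> sQ; pose i := fun z' : W => (y, z').
have si : smooth_near z i.
  by apply: smooth_near_pair; [exact: smooth_near_cst|exact: smooth_near_id].
have Di : 'D_x i z = (0, x).
  have d1 := smooth_near_differentiable (smooth_near_cst z y).
  have d2 := smooth_near_differentiable (smooth_near_id z).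
  rewrite (deriveE _ (differentiable_pair d1 d2)) (diff_pair d1 d2) /=.
  by rewrite diff_cst diff_val.
by rewrite -Di; exact: (derive_smooth_comp x si sQ).
Qed.

Lemma near_smooth_near V W Z (x : V) (f : V -> W) (g : W -> Z) :
  {for x, continuous f} -> smooth_near (f x) g ->
  \forall y \near x, smooth_near (f y) g.
Proof. by move=> cf sg; exact: (cf _ (smooth_near_near sg)). Qed.

(** The inner derivative of [g] is taken in the direction ['D_b m] at the base point [m], and both
    move. Moving the direction gives the first term; moving the base point, with the direction
    frozen at [q], gives the Hessian term. For the action, [m] is the group law, the first term
    carries the Lie bracket and the second is symmetric. *)
Lemma derive2_comp V W Z (m : V -> W) (g : W -> Z) (q a b : V) :
  finite_coords W -> smooth_near q m -> smooth_near (m q) g ->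
  'D_a (fun q' => 'D_b (fun p => g (m p)) q') q =
  'D_('D_a (fun q' => 'D_b m q') q) g (m q)
  + 'D_('D_a m q) (fun p => 'D_('D_b m q) g p) (m q).
Proof.
move=> fW sm sg; have [I [e [c [cc ce]]]] := fW.
have Dlin w p : smooth_near p g -> 'D_w g p = \sum_i c i w *: 'D_(e i) g p.
  move=> /smooth_near_differentiable dg; rewrite deriveE// {1}(ce w) linear_sum.
  by apply: eq_bigr => i _; rewrite linearZ deriveE.
have N1 := smooth_near_near sm.
have N2 := near_smooth_near (smooth_near_continuous sm) sg.
have E1 : \forall q' \near q, 'D_b (fun p => g (m p)) q' =
    \sum_i c i ('D_b m q') *: 'D_(e i) g (m q').
  near=> q'; have s1 : smooth_near q' m by near: q'; exact: N1.
  have s2 : smooth_near (m q') g by near: q'; exact: N2.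
  by rewrite (derive_smooth_comp b s1 s2) Dlin.
have sDb := smooth_near_derive b sm.
have sc i : smooth_near q (fun q' => c i ('D_b m q')).
  exact: (smooth_near_comp fW sDb (smooth_near_linear _ (cc i))).
have se i : smooth_near q (fun q' => 'D_(e i) g (m q')).
  exact: (smooth_near_comp fW sm (smooth_near_derive _ sg)).
have E2 : \forall p \near m q, 'D_('D_b m q) g p =
    \sum_i c i ('D_b m q) *: 'D_(e i) g p.
  by have := smooth_near_near sg; apply: filterS => p sp; exact: Dlin.
have sce i : smooth_near (m q) (fun p => c i ('D_b m q) *: 'D_(e i) g p).
  by apply: smooth_nearZ; [exact: smooth_near_cst|exact: smooth_near_derive].
rewrite (near_eq_derive _ E1) (near_eq_derive _ E2).
rewrite derive_smooth_sum; last by move=> i; exact: smooth_nearZ.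
rewrite [X in _ + X]derive_smooth_sum// Dlin// addrC -big_split /=.
apply: eq_bigr => i _; have dse := smooth_near_derive (e i) sg.
rewrite (derive_smoothZ _ (sc i) (se i)).
rewrite (derive_smoothZ _ (smooth_near_cst _ _) dse) derive_cst scale0r addr0.
have F1 := derive_smooth_comp a sm dse.
have F2 := derive_smooth_comp a sDb (smooth_near_linear _ (cc i)).
by rewrite F1 F2 (derive_linear _ _ (cc i)).
Unshelve. all: by end_near. Qed.

End SecondOrder.

(** * Lie groups *)

Section LieGroup.
Variables (R : realType) (k : nat) (D : lie_group R k).
Implicit Types a b c : D.
Local Notation mul := (@lmul R k D).
Local Notation one := (lone D).
Local Notation inv := (@linv R k D).

Lemma lmulV_r a : mul a (inv a) = one.
Proof.
rewrite -[mul a _]lmul1 -{1}(lmulV (inv a)) -lmulA [mul (inv a) _]lmulA.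
by rewrite lmulV lmul1 lmulV.
Qed.

Lemma lmul1_r a : mul a one = a.
Proof. by rewrite -(lmulV a) lmulA lmulV_r lmul1. Qed.

Lemma linvM_mul a b c : mul (inv (mul a b)) (mul a c) = mul (inv b) c.
Proof.
have E : mul (mul a b) (mul (inv b) (inv a)) = one.
  by rewrite -lmulA [mul b _]lmulA lmulV_r lmul1 lmulV_r.
have -> : inv (mul a b) = mul (inv b) (inv a).
  by rewrite -[RHS]lmul1 -(lmulV (mul a b)) -lmulA E lmul1_r.
by rewrite -lmulA [mul (inv a) _]lmulA lmulV lmul1.
Qed.

Lemma plot_lmul (V : normedModType R) (x : V) (phi psi : V -> D) :
  plot x phi -> plot x psi -> plot x (fun y => mul (phi y) (psi y)).
Proof. exact: plot_smooth_map2 (@lmul_smooth R k D). Qed.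

Definition ocoord : 'rV[R]_k := coord_at one one.
Definition ochart : 'rV[R]_k -> D := cinv (chart_at one).

Lemma ochart_o : ochart ocoord = one.
Proof. by rewrite /ochart cmapK//; exact: chart_atP. Qed.

Lemma plot_ochart : plot ocoord ochart.
Proof. exact: plot_cinv (chart_atP one). Qed.

(** The group law in the chart at 1. Its first derivative at (o, o) is addition, and its mixed
    second derivatives there determine the Lie bracket. *)
Definition mul_coords (q : 'rV[R]_k * 'rV[R]_k) : 'rV[R]_k :=
  coord_at one (mul (ochart q.1) (ochart q.2)).

Local Notation fin1 := (@finite_coords_rV R k).

Lemma plot_mul2 :
  plot (ocoord, ocoord) (fun q => mul (ochart q.1) (ochart q.2)).
Proof.
apply: plot_lmul.
  by apply: (plot_comp fin1 (smooth_near_fst _)); exact: plot_ochart.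
by apply: (plot_comp fin1 (smooth_near_snd _)); exact: plot_ochart.
Qed.

Lemma mul2_oo : mul (ochart ocoord) (ochart ocoord) = one.
Proof. by rewrite ochart_o lmul1. Qed.

Lemma smooth_mul_coords : smooth_near (ocoord, ocoord) mul_coords.
Proof.
apply: (plot_coord plot_mul2) => /=; rewrite mul2_oo; exact: chart_atP.
Qed.

Lemma mul_coords_oo : mul_coords (ocoord, ocoord) = ocoord.
Proof. by rewrite /mul_coords mul2_oo. Qed.

Lemma mul_coords_fst x : 'D_((x, 0) : _ * _) mul_coords (ocoord, ocoord) = x.
Proof.
rewrite -(partial_fst x smooth_mul_coords).
rewrite (@near_eq_derive _ _ _ _ (fun y => y)); first exact: derive_id.
have := coord_cinv_near (chart_atP one); apply: filterS => y /=.
by rewrite /mul_coords /= ochart_o lmul1_r.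
Qed.

Lemma mul_coords_snd x : 'D_((0, x) : _ * _) mul_coords (ocoord, ocoord) = x.
Proof.
rewrite -(partial_snd x smooth_mul_coords).
rewrite (@near_eq_derive _ _ _ _ (fun y => y)); first exact: derive_id.
have := coord_cinv_near (chart_atP one); apply: filterS => y /=.
by rewrite /mul_coords /= ochart_o lmul1.
Qed.

(** Left-invariant fields move the right factor of a product, hence the derivative in the second
    variable. *)
Lemma left_invariant_coord y (w : 'rV[R]_k) :
  cdom (chart_at one) (ochart w) -> smooth_near (w, ocoord) mul_coords ->
  vf_apply (left_invariant y) (coord_at one) (ochart w) =
  'D_((0, y) : _ * _) mul_coords (w, ocoord).
Proof.
move=> cw sw; set a := ochart w.
have pa : plot ocoord (fun z => mul a (ochart z)).
  by apply: plot_lmul; [exact: plot_cst|exact: plot_ochart].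
have sa : smooth_at (mul a (ochart ocoord)) (coord_at one).
  by rewrite ochart_o lmul1_r; exact: smooth_at_coord.
have := smooth_at_derive y pa sa; rewrite ochart_o => E.
rewrite -(partial_snd y sw) E /vf_apply /left_invariant /tangent_map /tderiv.
by rewrite lmul1_r.
Qed.

Lemma left_invariant_one x : left_invariant (D := D) x one = x.
Proof.
rewrite /left_invariant /tangent_map lmul1.
rewrite [X in tderiv X](_ : _ = coord_at one); first exact: tderiv_coord.
by apply/funext => a /=; rewrite lmul1.
Qed.

Lemma left_invariant_coord2 x y :
  vf_apply (left_invariant x) (vf_apply (left_invariant y) (coord_at one)) one =
  'D_((x, 0) : _ * _) (fun q => 'D_((0, y) : _ * _) mul_coords q)
    (ocoord, ocoord).
Proof.
rewrite {1}/vf_apply left_invariant_one /tderiv.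
rewrite -(partial_fst x (smooth_near_derive _ smooth_mul_coords)).
apply: near_eq_derive.
have N1 : \forall w \near ocoord, cdom (chart_at one) (ochart w).
  apply: cdom_near; first by have [] := plot_ochart.
  by rewrite ochart_o; exact: chart_atP.
have N2 : \forall w \near ocoord, smooth_near (w, ocoord) mul_coords.
  apply: (@near_smooth_near _ _ _ _ _ (fun w => (w, ocoord))).
    apply: smooth_near_continuous; apply: smooth_near_pair.
      exact: smooth_near_id.
    exact: smooth_near_cst.
  exact: smooth_mul_coords.
by near=> w; apply: left_invariant_coord; near: w; [exact: N1|exact: N2].
Unshelve. all: by end_near. Qed.

(** The definition yields the mixed derivatives in the other order. They are exchanged here because
    for the action on S it is the derivative along the left factor that is taken first, as in
    [fund_apply2]. *)
Lemma lie_bracketE x y :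
  @lie_bracket R k D x y =
  'D_((0, y) : _ * _) (fun q => 'D_((x, 0) : _ * _) mul_coords q)
    (ocoord, ocoord)
  - 'D_((0, x) : _ * _) (fun q => 'D_((y, 0) : _ * _) mul_coords q)
    (ocoord, ocoord).
Proof.
rewrite /lie_bracket /vf_bracket !left_invariant_coord2.
have E u v := smooth_schwarz ((u, 0) : _ * _) ((0, v) : _ * _) fin1
  smooth_mul_coords.
exact: (congr2 (fun u v => u - v) (E x y) (E y x)).
Qed.

Section Exponential.
Variable exp : 'rV[R]_k -> D.
Hypothesis expP : is_exponential exp.

Lemma exp0 : exp 0 = one.
Proof.
have [/(_ 0 0) + _ _] := expP 0; rewrite addr0 !scaler0 => E.
by rewrite -(lmulV (exp 0)) {3}E lmulA lmulV lmul1.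
Qed.

Lemma plot_exp x : plot (0 : R^o) (fun t : R^o => exp (t *: x)).
Proof.
have [_ [c /(_ one) s] _] := expP x.
have one0 : exp ((0 : R) *: x) = one by rewrite scale0r exp0.
have c0 := c (0 : R).
apply: (@plotI _ _ _ _ _ _ one) => //; first by rewrite one0; exact: chart_atP.
apply: smooth_on_near s; apply: c0; apply: cdom_nbhs.
by rewrite one0; exact: chart_atP.
Qed.

Lemma derive_exp x :
  'D_1 (fun t : R^o => coord_at one (exp (t *: x))) (0 : R^o) = x.
Proof.
have [_ _] := expP x; rewrite /velocity scale0r exp0 derive1E => E.
by rewrite -[RHS]E.
Qed.

End Exponential.

(** * The adjoint action *)

Lemma tderiv_linear (W : normedModType R) m (f : D -> W) (a : R) u v :
  smooth_at m f -> tderiv f m (a *: u + v) = a *: tderiv f m u + tderiv f m v.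
Proof. exact: derive_smooth_linear. Qed.

Lemma smooth_at_lmull a b : smooth_at b (coord_at (mul a b) \o mul a).
Proof.
have p : plot (coord_at b b) (fun y => mul a (cinv (chart_at b) y)).
  by apply: plot_lmul; [exact: plot_cst|exact: plot_cinv (chart_atP b)].
apply: (plot_coord p); rewrite cmapK; exact: chart_atP.
Qed.

Lemma smooth_at_lmulr a b :
  smooth_at b (coord_at (mul b a) \o (fun c => mul c a)).
Proof.
have p : plot (coord_at b b) (fun y => mul (cinv (chart_at b) y) a).
  by apply: plot_lmul; [exact: plot_cinv (chart_atP b)|exact: plot_cst].
apply: (plot_coord p); rewrite cmapK; exact: chart_atP.
Qed.

(** A composite of the differentials of a left and a right translation, instead of the differential
    of conjugation, so that the two invariances of the scalar product apply to it one after the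
    other. *)
Definition Ad b (x : 'rV[R]_k) : 'rV[R]_k :=
  tangent_map (fun c => mul c (inv b)) b (tangent_map (mul b) one x).

Lemma Ad_linear b : linear (Ad b).
Proof.
move=> a u v; rewrite /Ad /tangent_map.
rewrite tderiv_linear ?tderiv_linear//; first exact: smooth_at_lmulr.
exact: smooth_at_lmull.
Qed.

Lemma tangent_curve (phi : R^o -> D) m m' (F : D -> D) :
  plot (0 : R^o) phi -> phi 0 = m -> F m = m' ->
  smooth_at m (coord_at m' \o F) ->
  'D_1 (fun t : R^o => coord_at m' (F (phi t))) (0 : R^o) =
  tangent_map F m ('D_1 (fun t : R^o => coord_at m (phi t)) (0 : R^o)).
Proof. by move=> p <- <- sf; exact: (smooth_at_derive (1 : R^o) p sf). Qed.

Lemma derive_conj (exp : 'rV[R]_k -> D) b x : is_exponential exp ->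
  'D_1 (fun t : R^o => coord_at one (mul (mul b (exp (t *: x))) (inv b)))
    (0 : R^o) = Ad b x.
Proof.
move=> expP; have e0 : exp ((0 : R) *: x) = one by rewrite scale0r exp0.
have p0 := plot_exp expP x.
have p1 : plot (0 : R^o) (fun t : R^o => mul b (exp (t *: x))).
  by apply: plot_lmul => //; exact: plot_cst.
have p1b : mul b (exp ((0 : R) *: x)) = b by rewrite e0 lmul1_r.
apply: etrans
  (tangent_curve (F := fun c => mul c (inv b)) p1 p1b (lmulV_r b) _) _.
  by rewrite -(lmulV_r b); exact: smooth_at_lmulr.
apply: (congr1 (tangent_map (fun c => mul c (inv b)) b)).
apply: etrans (tangent_curve (F := mul b) p0 e0 (lmul1_r b) _) _.
  by rewrite -{1}(lmul1_r b); exact: smooth_at_lmull.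
exact: (congr1 (tangent_map (mul b) one) (derive_exp expP x)).
Qed.

Lemma Ad_isometry (K : D -> 'rV[R]_k -> 'rV[R]_k -> R) b x y :
  biinvariant_scalar_product K -> K one (Ad b x) (Ad b y) = K one x y.
Proof.
move=> [_ _ Kl Kr]; rewrite -[RHS](Kl b one) lmul1_r.
by rewrite -[RHS](Kr (inv b) b) lmulV_r.
Qed.

End LieGroup.

Lemma derive_dirB (R : realType) (V W : normedModType R) (x u v : V)
    (f : V -> W) :
  smooth_near x f -> 'D_(u - v) f x = 'D_u f x - 'D_v f x.
Proof.
by move=> /smooth_near_differentiable df; rewrite !deriveE// linearB.
Qed.

Lemma addr_cancel_mid (M : zmodType) (a b c d : M) :
  c = d -> a + c - (b + d) = a - b.
Proof. by move=> ->; rewrite opprD addrACA subrr addr0. Qed.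

(** * The dressing action *)

Section SmoothAt.
Variables (R : realType) (k : nat) (M : manifold R k).

(** Smoothness at [p] refers to the chart at [p], not to the one at [m], so openness requires a
    change of chart; testing on plots performs it. *)
Lemma smooth_at_near (W : normedModType R) (m : M) (f : M -> W) :
  smooth_at m f -> \forall p \near m, smooth_at p f.
Proof.
move=> sf; have cm : {for m, continuous (coord_at m)}.
  by apply: cmap_continuous; exact: chart_atP.
have N1 : \forall p \near m,
    smooth_near (coord_at m p) (f \o cinv (chart_at m)).
  exact: (cm _ (smooth_near_near sf)).
have N2 := cdom_nbhs (chart_atP m).
near=> p; have sp : smooth_near (coord_at m p) (f \o cinv (chart_at m)).
  by near: p; exact: N1.
have dp : cdom (chart_at m) p by near: p; exact: N2.
apply: smooth_at_nbhs => V x phi xp; move: sp dp; rewrite -xp => sp dp pphi.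
have E := smooth_near_comp (@finite_coords_rV R k) (plot_coord pphi dp) sp.
apply: smooth_near_eq E; have [cphi _] := pphi.
have := cdom_near cphi dp; apply: filterS => y cy /=.
by rewrite /coord_at cmapK.
Unshelve. all: by end_near. Qed.

End SmoothAt.

Section DressingAction.
Variables (R : realType) (n : nat) (DG : group_pair R n).
Variable S : quotient_manifold DG.
Local Notation D := (gp_D DG).
Local Notation G := (@gp_G R n DG).
Local Notation g := (gp_g DG).
Local Notation B := (@gp_K R n DG (lone (gp_D DG))).
Local Notation br := (@lie_bracket R (n + n) (gp_D DG)).
Local Notation exp := (@gp_exp R n DG).
Local Notation mul := (@lmul R (n + n) D).
Local Notation inv := (@linv R (n + n) D).
Local Notation one := (lone D).
Local Notation dr := (@dressing R n DG S).
Local Notation xS := (@fund_field R n DG n S dr).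
Local Notation pi := (@qm_pi R n DG S).
Local Notation o := (@ocoord R (n + n) D).
Local Notation oc := (@ochart R (n + n) D).
Local Notation fin k := (@finite_coords_rV R k).

Lemma pi_representative (s : S) : pi (representative s) = s.
Proof.
have [a sa] := qm_pi_surj s.
exact: (@xgetPex _ one [set b | pi b = s] (ex_intro _ a sa)).
Qed.

Lemma dressing_pi a b : dr a (pi b) = pi (mul a b).
Proof.
apply/qm_pi_eq; rewrite linvM_mul; apply/qm_pi_eq.
exact: pi_representative.
Qed.

Lemma dressing1 s : dr one s = s.
Proof. by rewrite /dressing lmul1 pi_representative. Qed.

Lemma dressingM a b s : dr (mul a b) s = dr a (dr b s).
Proof. by have [c <-] := qm_pi_surj s; rewrite !dressing_pi lmulA. Qed.

(** [dressing] uses an arbitrary choice of representatives, which has no reason to be smooth. Its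
    value does not depend on that choice, so near a given point a smooth local section of the
    projection may replace it. *)
Lemma plot_dressing (V : normedModType R) (x : V) (phi : V -> D)
    (psi : V -> S) :
  plot x phi -> plot x psi -> plot x (fun y => dr (phi y) (psi y)).
Proof.
move=> pphi ppsi; have [U [sigma [oU Us ssigma sK]]] := qm_section (psi x).
have p1 : plot x (fun y => sigma (psi y)).
  by apply: plot_smooth_map ssigma _ ppsi; exact: open_nbhs_nbhs.
have p2 : plot x (fun y => pi (mul (phi y) (sigma (psi y)))).
  apply: (plot_smooth_map (qm_pi_smooth S)); first exact: filterT.
  exact: plot_lmul.
apply: plot_eq p2; have [cpsi _] := ppsi.
have N : nbhs x (psi @^-1` U) by apply: cpsi; exact: open_nbhs_nbhs.
by apply: filterS N => y Uy; rewrite -dressing_pi sK.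
Qed.

(* The orbit map a |-> a s of D, read in the chart of D at 1. *)
Definition orb (s : S) (y : 'rV[R]_(n + n)) : S := dr (oc y) s.

Lemma orb_o s : orb s o = s.
Proof. by rewrite /orb ochart_o dressing1. Qed.

Lemma plot_orb s : plot o (orb s).
Proof. by apply: plot_dressing; [exact: plot_ochart|exact: plot_cst]. Qed.

Lemma smooth_orb (W : normedModType R) s (f : S -> W) :
  smooth_at s f -> smooth_near o (fun y => f (orb s y)).
Proof. by move=> sf; apply: (smooth_at_plot (plot_orb s)); rewrite orb_o. Qed.

Lemma derive_dressing_curve (W : normedModType R) (phi : R^o -> D) s
    (f : S -> W) :
  plot (0 : R^o) phi -> phi 0 = one -> smooth_at s f ->
  'D_1 (fun t : R^o => f (dr (phi t) s)) (0 : R^o) =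
  'D_('D_1 (fun t : R^o => coord_at one (phi t)) (0 : R^o))
    (fun y => f (orb s y)) o.
Proof.
move=> [cphi sphi] phi0 sf.
have sphi' : smooth_near (0 : R^o) (fun t => coord_at one (phi t)).
  by move: sphi; rewrite phi0.
have o0 : coord_at one (phi 0) = o by rewrite phi0.
have so : smooth_near (coord_at one (phi 0)) (fun y => f (orb s y)).
  by rewrite o0; exact: smooth_orb.
have := derive_smooth_comp (1 : R^o) sphi' so; rewrite o0 => <-.
apply: near_eq_derive.
have d0 : cdom (chart_at one) (phi 0) by rewrite phi0; exact: chart_atP.
have := cdom_near cphi d0; apply: filterS => t ct /=.
by rewrite /orb /ochart /coord_at cmapK.
Qed.

(** Only the velocity of the curve exp(-tx) at 1 matters; the exponential disappears, and linearity
    in [x] becomes that of a differential. *)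
Lemma fund_fieldE x s : xS x s = 'D_(- x) (fun y => coord_at s (orb s y)) o.
Proof.
have expP := @gp_expP R n DG.
have e0 : exp ((0 : R) *: - x) = one by rewrite scale0r (exp0 expP).
have := derive_dressing_curve (plot_exp expP (- x)) e0
          (smooth_at_coord (chart_atP s)).
rewrite (derive_exp expP) => <-; rewrite /fund_field /velocity derive1E.
rewrite oppr0 scale0r (exp0 expP) dressing1.
apply: (congr1 (fun h : R^o -> 'rV[R]_n => 'D_(1 : R^o) h (0 : R^o))).
by apply/funext => t; rewrite scalerN -scaleNr.
Qed.

Lemma fund_field_linear s : linear (xS ^~ s).
Proof.
move=> a u v; rewrite !fund_fieldE opprD -scalerN.
exact: derive_smooth_linear (smooth_orb (smooth_at_coord (chart_atP s))).
Qed.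

Lemma fund_applyE (W : normedModType R) x s (f : S -> W) : smooth_at s f ->
  vf_apply (xS x) f s = 'D_(- x) (fun y => f (orb s y)) o.
Proof.
move=> sf; have sf' : smooth_at (orb s o) f by rewrite orb_o.
by rewrite (smooth_at_derive _ (plot_orb s) sf') orb_o /vf_apply fund_fieldE.
Qed.

Lemma smooth_orb2 (V W : normedModType R) (p : V) (phi : V -> S) (f : S -> W) :
  finite_coords V -> plot p phi -> smooth_at (phi p) f ->
  smooth_near (o, p) (fun q : 'rV[R]_(n + n) * V => f (orb (phi q.2) q.1)).
Proof.
move=> fV pphi sf.
have p1 : plot (o, p) (fun q : 'rV[R]_(n + n) * V => oc q.1).
  by apply: (plot_comp (fin _) (smooth_near_fst _)); exact: plot_ochart.
have p2 : plot (o, p) (fun q : 'rV[R]_(n + n) * V => phi q.2).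
  exact: (plot_comp fV (smooth_near_snd _)).
apply: (smooth_at_plot (plot_dressing p1 p2)) => /=.
by rewrite ochart_o dressing1.
Qed.

(** Near [s], the function x_S f is a partial derivative, in the group variable, of a jointly smooth
    function of the group coordinate and the point. *)
Lemma smooth_at_fund (W : normedModType R) x s (f : S -> W) :
  smooth_at s f -> smooth_at s (vf_apply (xS x) f).
Proof.
move=> sf; set phi := cinv (chart_at s); set p := coord_at s s.
have phip : phi p = s by rewrite /phi cmapK//; exact: chart_atP.
have sf' : smooth_at (phi p) f by rewrite phip.
have pphi : plot p phi := plot_cinv (chart_atP s).
have sQ := smooth_orb2 (fin n) pphi sf'.
have si : smooth_near p (fun v : 'rV[R]_n => (o, v)).
  by apply: smooth_near_pair; [exact: smooth_near_cst|exact: smooth_near_id].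
have fp := finite_coords_prod (fin (n + n)) (fin n).
have sD := smooth_near_comp fp si (smooth_near_derive ((- x, 0) : _ * _) sQ).
apply: smooth_near_eq sD.
have N1 := near_smooth_near (smooth_near_continuous si) sQ.
have N2 : \forall v \near p, smooth_at (phi v) f.
  exact: (near_cinv (chart_atP s) (smooth_at_near sf)).
near=> v; have sQv : smooth_near (o, v) (fun q => f (orb (phi q.2) q.1)).
  by near: v; exact: N1.
have sfv : smooth_at (phi v) f by near: v; exact: N2.
by rewrite /= (fund_applyE x sfv); exact: esym (partial_fst (- x) sQv).
Unshelve. all: by end_near. Qed.

Lemma fund_applyN (W : normedModType R) x s (f : S -> W) : smooth_at s f ->
  vf_apply (xS x) f s = - 'D_x (fun y => f (orb s y)) o.
Proof.
by move=> sf; rewrite fund_applyE// -sub0r (derive_dirB _ _ (smooth_orb sf))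
  derive0 sub0r.
Qed.

Lemma orb_mul s w z : orb (orb s z) w = dr (mul (oc w) (oc z)) s.
Proof. by rewrite /orb dressingM. Qed.

(** The inner field acts through [q.1] and the outer one moves the base point through [q.2], so the
    left side is a mixed second derivative of f(w (z s)), the two minus signs cancelling. Since w (z
    s) = (w z) s, this is a function of the group law, and [derive2_comp] splits it. *)
Lemma fund_apply2 x y s (f : S -> R^o) : smooth_at s f ->
  vf_apply (xS x) (vf_apply (xS y) f) s =
  'D_('D_((0, x) : _ * _) (fun q => 'D_((y, 0) : _ * _) (@mul_coords R _ D) q)
        (o, o)) (fun p => f (orb s p)) o
  + 'D_x (fun p => 'D_y (fun p => f (orb s p)) p) o.
Proof.
move=> sf; pose H q := f (orb (orb s q.2) q.1).
have sfo : smooth_at (orb s o) f by rewrite orb_o.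
have sH : smooth_near (o, o) H := smooth_orb2 (fin _) (plot_orb s) sfo.
have sm := @smooth_mul_coords R _ D.
have so : smooth_near (mul_coords D (o, o)) (fun p => f (orb s p)).
  by rewrite mul_coords_oo; exact: smooth_orb.
have E := derive2_comp ((0, x) : _ * _) ((y, 0) : _ * _) (fin _) sm so.
rewrite mul_coords_oo mul_coords_fst mul_coords_snd in E.
rewrite -E fund_applyN; last exact: smooth_at_fund.
have HE : \forall q \near (o, o), f (orb s (mul_coords D q)) = H q.
  have [c2 _] := plot_mul2 D.
  have d2 : cdom (chart_at one) (mul (oc (o, o).1) (oc (o, o).2)).
    by rewrite /= mul2_oo; exact: chart_atP.
  have := cdom_near c2 d2; apply: filterS => q cq.
  by rewrite /H orb_mul /orb /mul_coords /coord_at /ochart cmapK.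
have HD : \forall q \near (o, o),
   'D_((y, 0) : _ * _) (fun q => f (orb s (mul_coords D q))) q =
   'D_((y, 0) : _ * _) H q.
  have := nbhs_interior HE; apply: filterS => q; exact: near_eq_derive.
rewrite (near_eq_derive _ HD) -(partial_snd x (smooth_near_derive _ sH)).
have si : smooth_near o (fun v : 'rV[R]_(n + n) => (o, v)).
  by apply: smooth_near_pair; [exact: smooth_near_cst|exact: smooth_near_id].
have N1 := near_smooth_near (smooth_near_continuous si) sH.
have N2 : \forall v \near o, smooth_at (orb s v) f.
  have [c _] := plot_orb s.
  exact: (c _ (smooth_at_near sfo)).
pose K v := 'D_((y, 0) : _ * _) H (o, v).
have NK : \forall v \near o, vf_apply (xS y) f (orb s v) = -1 *: K v.
  near=> v; have sHv : smooth_near (o, v) H by near: v; exact: N1.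
  have sfv : smooth_at (orb s v) f by near: v; exact: N2.
  rewrite (fund_applyN y sfv) scaleN1r.
  exact: (congr1 -%R (partial_fst y sHv)).
have sK : smooth_near o K.
  have fp := finite_coords_prod (fin (n + n)) (fin (n + n)).
  exact: (smooth_near_comp fp si (smooth_near_derive ((y, 0) : _ * _) sH)).
rewrite (near_eq_derive _ NK) derive_smoothZ//; last exact: smooth_near_cst.
by rewrite derive_cst scale0r addr0 scaleN1r opprK.
Unshelve. all: by end_near. Qed.

(** The Hessian terms cancel by symmetry. What remains is the derivative in the direction -[x, y],
    which by the sign in the definition of fundamental fields is the field of [x, y]. *)
Lemma fund_commutator x y s (f : S -> R^o) : smooth_at s f ->
  vf_apply (xS x) (vf_apply (xS y) f) s - vf_apply (xS y) (vf_apply (xS x) f) s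
  = vf_apply (xS (br x y)) f s.
Proof.
move=> sf; rewrite (fund_apply2 x y sf) (fund_apply2 y x sf).
have sf' := smooth_orb sf.
have C := smooth_schwarz x y (@finite_coords_reg R) sf'.
rewrite (fund_applyE _ sf) lie_bracketE opprB (derive_dirB _ _ sf').
exact: addr_cancel_mid C.
Qed.

End DressingAction.

(** * Linear algebra of a Manin pair *)

Section LinearMaps.
Variable R : realType.

Lemma linear_sum_fun (U W : lmodType R) (f : U -> W) (I : finType) (c : I -> R)
    (x : I -> U) : linear f -> f (\sum_i c i *: x i) = \sum_i c i *: f (x i).
Proof.
move=> lf.
pose L : {linear U -> W} := HB.pack f (GRing.isLinear.Build _ _ _ _ _ lf).
have -> : f = L by [].
by rewrite linear_sum; apply: eq_bigr => i _; rewrite linearZ.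
Qed.

Lemma linear_sub_fun (U W : lmodType R) (f : U -> W) x y :
  linear f -> f (x - y) = f x - f y.
Proof. by move=> lf; rewrite addrC -scaleN1r lf scaleN1r addrC. Qed.

Lemma linear_opp_fun (U W : lmodType R) (f : U -> W) x :
  linear f -> f (- x) = - f x.
Proof.
move=> lf; have f0 : f 0 = 0 by rewrite -(subrr 0) linear_sub_fun// subrr.
by rewrite -sub0r linear_sub_fun// f0 sub0r.
Qed.

Lemma linfunE (aT rT : vectType R) (f : aT -> rT) x :
  linear f -> linfun f x = f x.
Proof.
move=> lf.
pose L : {linear aT -> rT} := HB.pack f (GRing.isLinear.Build _ _ _ _ _ lf).
exact: (lfunE L x).
Qed.

Lemma injective_linear_surj (vT : vectType R) (f : vT -> vT) :
  linear f -> (forall x, f x = 0 -> x = 0) -> forall y, exists x, f x = y.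
Proof.
move=> lf f0 y; have E := linfunE _ lf.
have k0 : lker (linfun f) == 0%VS.
  apply/lker0P => u v; rewrite !E => uv.
  apply/eqP; rewrite -subr_eq0; apply/eqP.
  by apply: f0; rewrite linear_sub_fun// uv subrr.
by exists ((linfun f)^-1%VF y); rewrite -E lker0_lfunVK.
Qed.

End LinearMaps.

Section ManinAlgebra.
Variables (R : realType) (n : nat).
Local Notation V := 'rV[R]_(n + n).
Variables (br : V -> V -> V) (B : V -> V -> R) (g : {vspace V}).
Hypothesis MP : manin_pair br B g.

Let Bbil : Defs.bilinear B. Proof. by have [_ []] := MP. Qed.
Lemma B_sym x y : B x y = B y x. Proof. by have [_ []] := MP. Qed.
Lemma B_nondeg x : (forall y, B x y = 0) -> x = 0.
Proof. by have [_ [_ _ H _] _ _ _] := MP; exact: H. Qed.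
Lemma B_inv x y z : B (br x y) z = B x (br y z).
Proof. by have [_ []] := MP. Qed.
Lemma B_linl y : linear (fun x => B x y : R^o).
Proof. by move=> a u v; exact: Bbil.1. Qed.
Lemma B_linr x : linear (fun y => B x y : R^o).
Proof. by move=> a u v; exact: Bbil.2. Qed.
Lemma br_asym x y : br x y = - br y x. Proof. by have [[]] := MP. Qed.
Lemma br_linl y : linear (br ^~ y).
Proof. by have [[H _ _] _ _ _ _] := MP; move=> a u v; exact: H. Qed.
Lemma br_linr x : linear (br x).
Proof.
by move=> a u v; rewrite br_asym br_linl opprD -scalerN -!br_asym.
Qed.
Lemma g_subalg x y : x \in g -> y \in g -> br x y \in g.
Proof. by have [_ _ _ H _] := MP; exact: H. Qed.
Lemma g_isotropic x y : x \in g -> y \in g -> B x y = 0.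
Proof. by have [_ _ _ _ [H _]] := MP; exact: H. Qed.

Lemma B_Dl x y z : B (x + y) z = B x z + B y z.
Proof. by have := B_linl z 1 x y; rewrite !scale1r. Qed.
Lemma B_Dr x y z : B z (x + y) = B z x + B z y.
Proof. by rewrite !(B_sym z) B_Dl. Qed.
Lemma B_Nl x z : B (- x) z = - B x z.
Proof. exact: linear_opp_fun (B_linl z). Qed.
Lemma B_Nr x z : B z (- x) = - B z x.
Proof. by rewrite !(B_sym z) B_Nl. Qed.
Lemma B_sumr z (I : finType) (c : I -> R) (x : I -> V) :
  B z (\sum_i c i *: x i) = \sum_i c i * B z (x i).
Proof. exact: linear_sum_fun (B_linr z). Qed.
Lemma B_suml z (I : finType) (c : I -> R) (x : I -> V) :
  B (\sum_i c i *: x i) z = \sum_i c i * B (x i) z.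
Proof. exact: linear_sum_fun (B_linl z). Qed.

(** Nondegeneracy makes the map sending [u] to its pairings with the standard basis injective, and
    an injective endomorphism of a finite-dimensional space is onto. *)
Lemma riesz (a : V -> R^o) : linear a -> exists u, forall x, a x = B u x.
Proof.
move=> la; pose f (u : V) : V := \row_i B u (delta_mx 0 i).
have lf : linear f.
  by move=> c u v; apply/rowP => i; rewrite !mxE; exact: Bbil.1.
have f0 u : f u = 0 -> u = 0.
  move=> fu; apply: B_nondeg => y.
  rewrite (row_sum_delta y) B_sumr big1// => i _.
  by have := congr1 (fun w : V => w 0 i) fu; rewrite !mxE => ->; rewrite mulr0.
have [u fu] := injective_linear_surj lf f0 (\row_i a (delta_mx 0 i)).
exists u => x; rewrite (row_sum_delta x) B_sumr (linear_sum_fun _ _ la).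
apply: eq_bigr => i _; congr (_ * _).
by have := congr1 (fun w : V => w 0 i) fu; rewrite !mxE => ->.
Qed.

(** * Projections and dual bases relative to an isotropic complement *)

Section Complement.
Variable h : {vspace V}.
Hypothesis hP : isotropic_complement B g h.

Lemma h_isotropic x y : x \in h -> y \in h -> B x y = 0.
Proof. by have [H _ _] := hP; exact: H. Qed.

Lemma proj_g_in x : proj_g g h x \in g. Proof. exact: memv_pi. Qed.
Lemma proj_h_in x : proj_h g h x \in h. Proof. exact: memv_pi. Qed.
Lemma proj_add x : proj_g g h x + proj_h g h x = x.
Proof.
by have [_ i0 s] := hP; rewrite /proj_g /proj_h daddv_pi_add// s memvf.
Qed.

Local Notation pg := (proj_g g h).
Local Notation ph := (proj_h g h).

Lemma g_eq0 y : y \in g -> (forall z, z \in h -> B y z = 0) -> y = 0.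
Proof.
move=> yg yh; apply: B_nondeg => z; rewrite -(proj_add z) B_Dr.
by rewrite (yh _ (proj_h_in z)) (g_isotropic yg (proj_g_in z)) addr0.
Qed.

Lemma h_eq0 y : y \in h -> (forall z, z \in g -> B y z = 0) -> y = 0.
Proof.
move=> yh yg; apply: B_nondeg => z; rewrite -(proj_add z) B_Dr.
by rewrite (yg _ (proj_g_in z)) (h_isotropic yh (proj_h_in z)) addr0.
Qed.

Lemma g_orthogonal u : (forall y, y \in g -> B u y = 0) -> u \in g.
Proof.
move=> ug; rewrite -(proj_add u) (_ : ph u = 0) ?addr0 ?proj_g_in//.
apply: h_eq0 => [|z zg]; first exact: proj_h_in.
have := ug z zg; rewrite -{1}(proj_add u) B_Dl.
by rewrite (g_isotropic (proj_g_in u) zg) add0r.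
Qed.

Lemma B_ph_g u x : x \in g -> B (ph u) x = B u x.
Proof.
move=> xg; rewrite -{2}(proj_add u) B_Dl.
by rewrite (g_isotropic (proj_g_in u) xg) add0r.
Qed.

Lemma B_pg_h u x : x \in h -> B (pg u) x = B u x.
Proof.
move=> xh; rewrite -{2}(proj_add u) B_Dl.
by rewrite (h_isotropic (proj_h_in u) xh) addr0.
Qed.

Lemma jmap_unique (xi : dual R g) y : y \in h ->
  (forall x : subvs_of g, B y (vsval x) = xi x) -> jmap B h xi = y.
Proof.
move=> yh yxi.
have [jh jxi] : jmap B h xi \in h /\
    forall x : subvs_of g, B (jmap B h xi) (vsval x) = xi x.
  exact: (@xgetPex _ 0 [set y | y \in h /\
    forall x : subvs_of g, B y (vsval x) = xi x] (ex_intro _ y (conj yh yxi))).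
apply/eqP; rewrite -subr_eq0; apply/eqP; apply: h_eq0 => [|z zg].
  by rewrite rpredB.
by rewrite B_Dl B_Nl -(vsprojK zg) jxi yxi subrr.
Qed.

(** This evaluates [jmap], defined by choice, wherever it occurs: for a form on [g] represented by a
    vector [u] of the double, j returns the [h]-component of [u], because the [g]-component pairs to
    zero with [g]. *)
Lemma jmap_ph (xi : dual R g) u :
  (forall x : subvs_of g, xi x = B u (vsval x)) -> jmap B h xi = ph u.
Proof.
move=> xiu; apply: jmap_unique => [|x]; first exact: proj_h_in.
by rewrite xiu B_ph_g//; exact: subvsP.
Qed.

Local Notation e i := ((vbasis g)`_i).
Local Notation j i := (jmap B h (dual_basis i)).

Lemma dual_basisE i (x : subvs_of g) :
  @dual_basis R _ g i x = coord (vbasis g) i (vsval x).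
Proof. by rewrite /dual_basis linfunE// => a u v; rewrite !linearP. Qed.

Lemma j_spec i :
  j i \in h /\ forall x, x \in g -> B (j i) x = coord (vbasis g) i x.
Proof.
have ll : linear (fun x => coord (vbasis g) i (pg x) : R^o).
  by move=> a u v; rewrite /proj_g !linearP.
have [u uE] := riesz ll.
have jE : j i = ph u.
  apply: jmap_ph => x; rewrite dual_basisE -uE /proj_g daddv_pi_id ?subvsP//.
  by have [] := hP.
rewrite jE; split=> [|x xg]; first exact: proj_h_in.
by rewrite B_ph_g// -uE /proj_g daddv_pi_id//; have [] := hP.
Qed.

Lemma e_in (i : 'I_(\dim g)) : e i \in g.
Proof. by apply: vbasis_mem; rewrite mem_nth// size_tuple. Qed.

Lemma sum_j u : \sum_(i < \dim g) B u (e i) *: j i = ph u.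
Proof.
apply/eqP; rewrite -subr_eq0; apply/eqP; apply: h_eq0 => [|z zg].
  rewrite rpredB ?proj_h_in// rpred_sum// => i _.
  by rewrite rpredZ//; have [] := j_spec i.
rewrite B_Dl B_Nl B_suml B_ph_g// {2}(coord_vbasis zg) B_sumr.
apply/eqP; rewrite subr_eq0; apply/eqP; apply: eq_bigr => i _.
by rewrite mulrC; congr (_ * _); have [_ ->] := j_spec i.
Qed.

Lemma sum_e u : \sum_(i < \dim g) B u (j i) *: e i = pg u.
Proof.
apply/eqP; rewrite -subr_eq0; apply/eqP; apply: g_eq0 => [|z zh].
  by rewrite rpredB ?proj_g_in// rpred_sum// => i _; rewrite rpredZ ?e_in.
rewrite B_Dl B_Nl B_suml B_pg_h//.
(* [z] lies in [h]; written as its own projection it can be expanded by [sum_j]. *)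
rewrite -[in X in _ - B u X](_ : ph z = z); last first.
  by rewrite /proj_h daddv_pi_id// capvC; have [] := hP.
rewrite -(sum_j z) B_sumr; apply/eqP; rewrite subr_eq0; apply/eqP.
by apply: eq_bigr => i _; rewrite mulrC (B_sym (e i)).
Qed.

(** Isotropy of both summands leaves only the cross terms. Where (u|v) = 0, this identity is the
    antisymmetry of the form -(v|p_h u), which is [P_S]. *)
Lemma B_cross u v : B u v = B v (ph u) + B u (ph v).
Proof.
rewrite -{1}(proj_add u) B_Dl addrC (B_sym (ph u)); congr (_ + _).
rewrite -(B_pg_h u (proj_h_in v)) -{1}(proj_add v) B_Dr.
by rewrite (g_isotropic (proj_g_in u) (proj_g_in v)) add0r.
Qed.

(* The Jacobiator of functions whose differentials are (u|.), (v|.), (w|.), after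
   [jacobi_sum]. *)
Lemma half_schouten_algebra u v w :
  \sum_(i < \dim g) \sum_(k < \dim g)
      B u (e i) * B v (e k) * B w (br (j i) (j k))
  + \sum_(i < \dim g) \sum_(k < \dim g)
      B u (e i) * B v (br (j i) (e k)) * B w (j k)
  + \sum_(i < \dim g) \sum_(k < \dim g)
      B u (br (e i) (e k)) * B v (j i) * B w (j k)
  = B w (pg (br (ph u) (ph v))).
Proof.
have S1 : \sum_(i < \dim g) \sum_(k < \dim g)
      B u (e i) * B v (e k) * B w (br (j i) (j k)) =
    B w (br (ph u) (ph v)).
  rewrite -(sum_j u) (linear_sum_fun _ _ (br_linl _)) B_sumr.
  apply: eq_bigr => i _; rewrite -(sum_j v) (linear_sum_fun _ _ (br_linr _)).
  by rewrite B_sumr mulr_sumr; apply: eq_bigr => k _; rewrite mulrA.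
have S2 : \sum_(i < \dim g) \sum_(k < \dim g)
      B u (e i) * B v (br (j i) (e k)) * B w (j k) =
    B v (br (ph u) (pg w)).
  rewrite -(sum_j u) (linear_sum_fun _ _ (br_linl _)) B_sumr.
  apply: eq_bigr => i _; rewrite -(sum_e w) (linear_sum_fun _ _ (br_linr _)).
  rewrite B_sumr mulr_sumr; apply: eq_bigr => k _.
  by rewrite -mulrA [X in _ * X]mulrC.
have S3 : \sum_(i < \dim g) \sum_(k < \dim g)
      B u (br (e i) (e k)) * B v (j i) * B w (j k) =
    B u (br (pg v) (pg w)).
  rewrite -(sum_e v) (linear_sum_fun _ _ (br_linl _)) B_sumr.
  apply: eq_bigr => i _; rewrite -(sum_e w) (linear_sum_fun _ _ (br_linr _)).
  rewrite B_sumr mulr_sumr; apply: eq_bigr => k _.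
  by rewrite -mulrA mulrC -mulrA.
rewrite S1 S2 S3.
set X := br (ph u) (ph v).
(* The sums are now (w|[p_h u, p_h v]), (v|[p_h u, p_g w]) and (u|[p_g v, p_g w]). In [E1], [E2],
   [E3] invariance and the isotropy of the subalgebra [g] bring all terms but (w|p_g X) to pairings
   with p_g w, and these cancel in pairs. *)
have E1 : B w X = B w (pg X) + B (pg w) X.
  rewrite -{1}(proj_add X) B_Dr; congr (_ + _).
  rewrite -(B_pg_h w (proj_h_in X)) -[in RHS](proj_add X) B_Dr.
  by rewrite (g_isotropic (proj_g_in w) (proj_g_in X)) add0r.
have E2 : B v (br (ph u) (pg w)) = B (pg w) (br (pg v) (ph u)) - B (pg w) X.
  have -> : B v (br (ph u) (pg w)) = B (pg w) (br v (ph u)).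
    by rewrite -B_inv B_sym.
  rewrite -{1}(proj_add v) addrC; have := br_linl (ph u) 1 (ph v) (pg v).
  by rewrite !scale1r => ->; rewrite B_Dr addrC (br_asym (ph v)) B_Nr.
have E3 : B u (br (pg v) (pg w)) = - B (pg w) (br (pg v) (ph u)).
  have N := g_subalg (proj_g_in v) (proj_g_in w).
  rewrite -{1}(proj_add u) B_Dl (g_isotropic (proj_g_in u) N) add0r.
  by rewrite -B_inv br_asym B_Nl B_sym.
by rewrite E1 E2 E3 addrACA subrr addr0 addrK.
Qed.

(** By invariance the sum is (v|[x, p_h u]) - (v|p_h [x, u]). As [g] is a subalgebra, [x, u] and Y =
    [x, p_h u] have the same [h]-component, so only (v|p_g Y) = (p_h v|Y) is left, and invariance
    moves the bracket onto p_h u and p_h v. *)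
Lemma lie_derivative_algebra x u v : x \in g ->
  \sum_(i < \dim g)
    (B u (br x (e i)) * B v (j i) + B u (e i) * B v (br x (j i))) =
  B (ph (br (ph u) (ph v))) x.
Proof.
move=> xg; rewrite big_split /=.
have S1 : \sum_(i < \dim g) B u (br x (e i)) * B v (j i) = - B v (ph (br x u)).
  have -> : ph (br x u) = - ph (br u x).
    by rewrite br_asym /proj_h linearN.
  rewrite B_Nr opprK -(sum_j (br u x)) B_sumr.
  by apply: eq_bigr => i _; rewrite B_inv.
have S2 : \sum_(i < \dim g) B u (e i) * B v (br x (j i)) = B v (br x (ph u)).
  by rewrite -(sum_j u) (linear_sum_fun _ _ (br_linr _)) B_sumr.
have Eu : br x u = br x (pg u) + br x (ph u).
  have := br_linr x 1 (pg u) (ph u).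
  by rewrite !scale1r proj_add.
have Ep : ph (br x u) = ph (br x (ph u)).
  rewrite Eu /proj_h linearD /= (_ : daddv_pi h g (br x (pg u)) = 0) ?add0r//.
  have zg : br x (pg u) \in g by rewrite g_subalg ?proj_g_in.
  apply/eqP; rewrite -[X in X == _](addKr (pg (br x (pg u)))).
  rewrite -/(ph (br x (pg u))) proj_add /proj_g daddv_pi_id ?addNr//.
  by have [] := hP.
rewrite S1 S2 Ep B_ph_g//; set Y := br x (ph u).
rewrite -{2}(proj_add Y) B_Dr addrC addrK.
rewrite -{1}(proj_add v) B_Dl (g_isotropic (proj_g_in v) (proj_g_in Y)) add0r.
have -> : B (ph v) (pg Y) = B (ph v) Y.
  rewrite -[in RHS](proj_add Y) B_Dr.
  by rewrite (h_isotropic (proj_h_in v) (proj_h_in Y)) addr0.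
by rewrite B_sym /Y B_inv B_sym.
Qed.

End Complement.

(** An isometry is injective by nondegeneracy, hence onto, so [u] and [v] can be pulled back by [K]
    to vectors orthogonal to [g], which lie in [g]. It is applied to [Ad b]. *)
Lemma isometry_coisotropic (h : {vspace V}) (K : V -> V) u v :
  isotropic_complement B g h ->
  linear K -> (forall x y, B (K x) (K y) = B x y) ->
  (forall y, y \in g -> B u (K y) = 0) ->
  (forall y, y \in g -> B v (K y) = 0) ->
  B u v = 0.
Proof.
move=> hP lK KB uK vK.
have K0 x : K x = 0 -> x = 0.
  move=> Kx; apply: B_nondeg => y; rewrite -KB Kx.
  by rewrite -(subrr 0) B_Dl B_Nl subrr.
have sK := injective_linear_surj lK K0.
have [u' uE] := sK u; have [v' vE] := sK v.
rewrite -uE -vE KB; apply: g_isotropic; apply: (g_orthogonal hP) => y yg.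
  by rewrite -KB uE uK.
by rewrite -KB vE vK.
Qed.

End ManinAlgebra.

(** * The quasi-Poisson identities *)

(* [ef i], [jef i k], [jjh i k], ... stand for e_i f, j_i e_k f, j_i j_k h, ... at
   a point; the hypothesis is the antisymmetry of the bivector on (g, e_k f). *)
Lemma jacobi_sum (R : comRingType) (I : finType) (ef eg jg jh : I -> R)
    (eef jef jeg ejg jjh : I -> I -> R) :
  (forall k, \sum_i eg i * jef i k = - \sum_i eef i k * jg i) ->
  \sum_i ef i * (\sum_k (jeg i k * jh k + eg k * jjh i k))
  - \sum_i eg i * (\sum_k (jef i k * jh k + ef k * jjh i k))
  - \sum_k (\sum_i (eef k i * jg i + ef i * ejg k i)) * jh k =
  \sum_i \sum_k ef i * eg k * (jjh i k - jjh k i)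
  + \sum_i \sum_k ef i * (jeg i k - ejg k i) * jh k
  + \sum_i \sum_k (eef i k - eef k i) * jg i * jh k.
Proof.
move=> A.
have T1 : \sum_i ef i * (\sum_k (jeg i k * jh k + eg k * jjh i k)) =
    \sum_i \sum_k (ef i * jeg i k * jh k + ef i * eg k * jjh i k).
  apply: eq_bigr => i _; rewrite mulr_sumr; apply: eq_bigr => k _.
  by rewrite mulrDr !mulrA.
(* The terms [jef] have no counterpart in the other two sums; hypothesis [A] trades them for [eef],
   after which all second-order terms pair into commutators. *)
have T2 : \sum_i eg i * (\sum_k (jef i k * jh k + ef k * jjh i k)) =
    \sum_i \sum_k (- (eef i k * jg i * jh k) + ef i * eg k * jjh k i).
  under eq_bigr do rewrite mulr_sumr; rewrite exchange_big /=.
  under eq_bigr do under eq_bigr do rewrite mulrDr.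
  under eq_bigr do rewrite big_split /=.
  under [RHS]eq_bigr do rewrite big_split /=.
  rewrite !big_split /=; congr (_ + _).
    rewrite [RHS]exchange_big /=; apply: eq_bigr => k _.
    under eq_bigr do rewrite mulrA; rewrite -mulr_suml A mulNr mulr_suml.
    by rewrite -sumrN.
  apply: eq_bigr => k _; apply: eq_bigr => i _.
  by rewrite mulrCA mulrA.
have T3 : \sum_k (\sum_i (eef k i * jg i + ef i * ejg k i)) * jh k =
    \sum_i \sum_k (eef k i * jg i * jh k + ef i * ejg k i * jh k).
  rewrite exchange_big /=; apply: eq_bigr => k _; rewrite mulr_suml.
  by apply: eq_bigr => i _; rewrite mulrDl.
rewrite T1 T2 T3 -!sumrB -!big_split /=; apply: eq_bigr => i _.
rewrite -!sumrB -!big_split /=; apply: eq_bigr => k _.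
ring.
Qed.

Section SmoothAtOps.
Variables (R : realType) (k : nat) (M : manifold R k) (m : M).

Lemma smooth_atN (f : M -> R^o) : smooth_at m f -> smooth_at m (fun p => - f p).
Proof.
move=> sf; have s1 := smooth_near_cst (coord_at m m) (-1 : R^o).
apply: smooth_near_eq (smooth_nearZ s1 sf).
by near=> p; rewrite /= scaleN1r.
Unshelve. all: by end_near. Qed.

Lemma smooth_at_sumM (I : finType) (F G : I -> M -> R^o) :
  (forall i, smooth_at m (F i)) -> (forall i, smooth_at m (G i)) ->
  smooth_at m (fun p => \sum_i F i p * G i p).
Proof.
move=> sF sG.
exact: (smooth_near_sum _ (fun i => smooth_nearZ (sF i) (sG i))).
Qed.

Lemma tderivN (f : M -> R^o) v : smooth_at m f ->
  tderiv (fun p => - f p) m v = - tderiv f m v.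
Proof.
move=> sf; have d := smooth_near_differentiable sf.
rewrite /tderiv -deriveN//; exact: diff_derivable.
Qed.

Lemma tderiv_sumM (I : finType) (F G : I -> M -> R^o) v :
  (forall i, smooth_at m (F i)) -> (forall i, smooth_at m (G i)) ->
  tderiv (fun p => \sum_i F i p * G i p) m v =
  \sum_i (tderiv (F i) m v * G i m + F i m * tderiv (G i) m v).
Proof.
move=> sF sG; have E := derive_smooth_sum v _
  (fun i => smooth_nearZ (sF i) (sG i)).
apply: etrans (E _) _; apply: eq_bigr => i _.
apply: etrans (derive_smoothZ v (sF i) (sG i)) _.
rewrite /= cmapK; last exact: chart_atP.
exact: addrC.
Qed.

Lemma tderiv_is_linear (f : M -> R^o) : smooth_at m f ->
  linear (tderiv f m : 'rV[R]_k -> R^o).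
Proof. by move=> sf a u v; exact: derive_smooth_linear. Qed.

Lemma dfunE (f : M -> R^o) v : smooth_at m f -> dfun f m v = tderiv f m v.
Proof. by move=> sf; rewrite /dfun linfunE//; exact: tderiv_is_linear. Qed.

End SmoothAtOps.

Section Main.
Variables (R : realType) (n : nat) (DG : group_pair R n).
Variable S : quotient_manifold DG.
Local Notation D := (gp_D DG).
Local Notation G := (@gp_G R n DG).
Local Notation g := (gp_g DG).
Local Notation B := (@gp_K R n DG (lone (gp_D DG))).
Local Notation br := (@lie_bracket R (n + n) (gp_D DG)).
Local Notation exp := (@gp_exp R n DG).
Local Notation mul := (@lmul R (n + n) D).
Local Notation inv := (@linv R (n + n) D).
Local Notation one := (lone D).
Local Notation dr := (@dressing R n DG S).
Local Notation xS := (@fund_field R n DG n S dr).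
Local Notation pi := (@qm_pi R n DG S).
Local Notation PS := (@P_S R n DG S).
Local Notation A x f := (vf_apply (xS x) f).
Local Notation e i := ((vbasis g)`_i).
Local Notation j h i := (jmap B h (dual_basis i)).
Local Notation MP := (gp_manin DG).
Local Notation ph h := (proj_h g h).

(** The curve b exp(ty) b^-1 has velocity [Ad b y] at 1 and stays in the stabilizer of the coset of
    [b], since exp(ty) lies in G. *)
Lemma fund_Ad b y : y \in g -> xS (Ad b y) (pi b) = 0.
Proof.
move=> /gp_gP yG; have expP := @gp_expP R n DG.
set s := pi b; have sc := smooth_at_coord (chart_atP s).
have [_ GM _] := @gp_G_subgroup R n DG.
have p : plot (0 : R^o) (fun t : R^o => mul (mul b (exp (t *: y))) (inv b)).
  apply: plot_lmul; last exact: plot_cst.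
  by apply: plot_lmul; [exact: plot_cst|exact: plot_exp].
have p0 : mul (mul b (exp ((0 : R) *: y))) (inv b) = one.
  by rewrite scale0r (exp0 expP) lmul1_r lmulV_r.
have E := derive_dressing_curve p p0 sc.
rewrite (derive_conj b y expP) in E.
have N := derive_dirB 0 (Ad b y) (smooth_orb sc).
rewrite fund_fieldE -sub0r; apply: etrans N _; rewrite derive0 sub0r.
apply/eqP; rewrite oppr_eq0 -E; apply/eqP.
have -> : (fun t : R^o =>
      coord_at s (dr (mul (mul b (exp (t *: y))) (inv b)) s)) =
    fun=> coord_at s s; last exact: derive_cst.
apply/funext => t; congr coord_at.
rewrite /s dressing_pi; apply/esym/qm_pi_eq.
by rewrite -!lmulA lmulV lmul1_r lmulA lmulV lmul1; exact: yG.
Qed.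

Lemma covector_riesz (m : S) (al : covector R n) :
  exists u, forall x, al (xS x m) = B u x.
Proof.
apply: (riesz MP (a := fun x => al (xS x m))) => a x y.
by rewrite fund_field_linear linearP.
Qed.

Lemma covectors_isotropic (m : S) (al be : covector R n) h u v :
  complement DG h ->
  (forall x, al (xS x m) = B u x) -> (forall x, be (xS x m) = B v x) ->
  B u v = 0.
Proof.
move=> hP uE vE; have [b mb] := qm_pi_surj m.
apply: (isometry_coisotropic MP hP (@Ad_linear _ _ D b)).
- by move=> x y; exact: Ad_isometry (@gp_KP R n DG).
- by move=> y yg; rewrite -uE -mb fund_Ad// linear0.
- by move=> y yg; rewrite -vE -mb fund_Ad// linear0.
Qed.

Lemma P_S_riesz h (m : S) (al be : covector R n) u v : complement DG h ->
  (forall x, al (xS x m) = B u x) -> (forall x, be (xS x m) = B v x) ->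
  PS h m al be = - B v (ph h u).
Proof.
move=> hP uE vE; rewrite /P_S; congr (- _).
rewrite -(sum_j MP hP u) (B_sumr MP); apply: eq_bigr => i _.
by rewrite uE vE.
Qed.

Lemma P_S_anti h (m : S) (al be : covector R n) : complement DG h ->
  PS h m al be = - PS h m be al.
Proof.
move=> hP; have [u uE] := covector_riesz m al.
have [v vE] := covector_riesz m be.
rewrite (P_S_riesz hP uE vE) (P_S_riesz hP vE uE) opprK.
have := covectors_isotropic hP uE vE.
by rewrite (B_cross MP hP) addrC => /eqP; rewrite addr_eq0 => /eqP.
Qed.

Lemma dfun_fund (m : S) (f : S -> R^o) x : smooth_at m f ->
  dfun f m (xS x m) = A x f m.
Proof. by move=> sf; rewrite dfunE. Qed.

Lemma poissonE h (m : S) (f1 f2 : S -> R^o) :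
  smooth_at m f1 -> smooth_at m f2 ->
  poisson (PS h) f1 f2 m =
  - \sum_(i < \dim g) A (e i) f1 m * A (j h i) f2 m.
Proof.
move=> s1 s2; rewrite /poisson /P_S; congr (- _); apply: eq_bigr => i _.
by rewrite !dfun_fund.
Qed.

(** The expression through derivations is available where the functions are smooth, [dfun] being a
    linear form built from [tderiv]. To differentiate a bracket at [m], it is needed on a whole
    neighbourhood. *)
Lemma poisson_near h (m : S) (f1 f2 : S -> R^o) :
  smooth_at m f1 -> smooth_at m f2 ->
  \forall p \near m, - (\sum_(i < \dim g) A (e i) f1 p * A (j h i) f2 p) =
  poisson (PS h) f1 f2 p.
Proof.
move=> s1 s2; have N1 := smooth_at_near s1; have N2 := smooth_at_near s2.
near=> p; apply/esym/poissonE; near: p; [exact: N1|exact: N2].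
Unshelve. all: by end_near. Qed.

Lemma smooth_at_fund_sum h (m : S) (f1 f2 : S -> R^o) :
  smooth_at m f1 -> smooth_at m f2 ->
  smooth_at m (fun p => \sum_(i < \dim g) A (e i) f1 p * A (j h i) f2 p).
Proof.
move=> s1 s2; apply: smooth_at_sumM => i; exact: smooth_at_fund.
Qed.

Lemma smooth_at_poisson h (m : S) (f1 f2 : S -> R^o) :
  smooth_at m f1 -> smooth_at m f2 -> smooth_at m (poisson (PS h) f1 f2).
Proof.
move=> s1 s2; apply: smooth_at_eq (poisson_near h s1 s2) _.
by apply: smooth_atN; exact: smooth_at_fund_sum.
Qed.

Lemma fund_poisson h x (m : S) (f1 f2 : S -> R^o) :
  smooth_at m f1 -> smooth_at m f2 ->
  A x (poisson (PS h) f1 f2) m =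
  - \sum_(i < \dim g) (A x (A (e i) f1) m * A (j h i) f2 m +
                       A (e i) f1 m * A x (A (j h i) f2) m).
Proof.
move=> s1 s2; apply: etrans (esym (tderiv_eq _ (poisson_near h s1 s2))) _.
apply: etrans (tderivN _ (smooth_at_fund_sum h s1 s2)) _.
congr (- _); apply: tderiv_sumM => i; exact: smooth_at_fund.
Qed.

Lemma fund_covector (m : S) (f : S -> R^o) u : smooth_at m f ->
  (forall x, dfun f m (xS x m) = B u x) -> forall x, A x f m = B u x.
Proof. by move=> sf uE x; rewrite -uE dfun_fund. Qed.

Lemma poisson_anti h (m : S) (f1 f2 : S -> R^o) : complement DG h ->
  smooth_at m f1 -> smooth_at m f2 ->
  \sum_(i < \dim g) A (e i) f1 m * A (j h i) f2 m =
  - \sum_(i < \dim g) A (e i) f2 m * A (j h i) f1 m.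
Proof.
move=> hP s1 s2; apply: oppr_inj.
rewrite -(poissonE h s1 s2) -(poissonE h s2 s1); exact: P_S_anti.
Qed.

Lemma fund_transposeE (m : S) (al : covector R n) u :
  (forall x, al (xS x m) = B u x) -> forall y : subvs_of g,
  @fund_transpose R n DG n S dr m al y = B u (vsval y).
Proof.
move=> uE y; rewrite /fund_transpose linfunE ?uE// => a x z.
by rewrite linearP fund_field_linear linearP.
Qed.

Lemma half_schouten_dressing h (m : S) (f1 f2 f3 : S -> R^o) :
  complement DG h ->
  smooth_at m f1 -> smooth_at m f2 -> smooth_at m f3 ->
  half_schouten (PS h) f1 f2 f3 m =
  fund_tensor3 dr (phi_ br B h) m (dfun f1 m) (dfun f2 m) (dfun f3 m).
Proof.
move=> hP s1 s2 s3.
have [u uE] := covector_riesz m (dfun f1 m).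
have [v vE] := covector_riesz m (dfun f2 m).
have [w wE] := covector_riesz m (dfun f3 m).
have AB (a b : S -> R^o) : poisson (PS h) a b m = - poisson (PS h) b a m.
  exact: P_S_anti.
have T1 : poisson (PS h) f1 (poisson (PS h) f2 f3) m =
    \sum_(i < \dim g) A (e i) f1 m *
     (\sum_(k < \dim g) (A (j h i) (A (e k) f2) m * A (j h k) f3 m +
                         A (e k) f2 m * A (j h i) (A (j h k) f3) m)).
  rewrite poissonE//; last exact: smooth_at_poisson.
  rewrite -sumrN; apply: eq_bigr => i _.
  apply: etrans (congr1 (fun z => - (A (e i) f1 m * z))
                        (fund_poisson h (j h i) s2 s3)) _.
  by rewrite mulrN opprK.
have T2 : poisson (PS h) f2 (poisson (PS h) f3 f1) m =
    - \sum_(i < \dim g) A (e i) f2 m *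
     (\sum_(k < \dim g) (A (j h i) (A (e k) f1) m * A (j h k) f3 m +
                         A (e k) f1 m * A (j h i) (A (j h k) f3) m)).
  (* Antisymmetry is used, here and in [T3], to put the functions in the order f1, f2, f3: the
     fields e_i then never act on f3, nor the fields j_i on f1 except through e_k f1. It must hold
     near [m] because the bracket is about to be differentiated. *)
  have E : \forall p \near m, - poisson (PS h) f1 f3 p = poisson (PS h) f3 f1 p.
    by near=> p; rewrite [RHS]P_S_anti.
  rewrite poissonE//; last exact: smooth_at_poisson.
  congr (- _); apply: eq_bigr => i _; congr (_ * _).
  apply: etrans (esym (tderiv_eq _ E)) _.
  apply: etrans (tderivN _ (smooth_at_poisson h s1 s3)) _.
  apply: etrans (congr1 -%R (fund_poisson h (j h i) s1 s3)) _.
  by rewrite opprK.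
have T3 : poisson (PS h) f3 (poisson (PS h) f1 f2) m =
    - \sum_(k < \dim g)
        (\sum_(i < \dim g) (A (e k) (A (e i) f1) m * A (j h i) f2 m +
                            A (e i) f1 m * A (e k) (A (j h i) f2) m))
        * A (j h k) f3 m.
  have sp := smooth_at_poisson h s1 s2.
  rewrite AB poissonE// opprK -sumrN; apply: eq_bigr => k _.
  apply: etrans (congr1 (fun z => z * A (j h k) f3 m)
                        (fund_poisson h (e k) s1 s2)) _.
  by rewrite mulNr.
rewrite /half_schouten T1 T2 T3.
(* Antisymmetry for the pair f2 and e_k f1, the second being again smooth at [m]. *)
have An k : \sum_(i < \dim g) A (e i) f2 m * A (j h i) (A (e k) f1) m =
    - \sum_(i < \dim g) A (e i) (A (e k) f1) m * A (j h i) f2 m.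
  by apply: poisson_anti => //; exact: smooth_at_fund.
pose I := 'I_(\dim g).
apply: etrans (jacobi_sum
  (fun i : I => A (e i) f1 m) (fun i : I => A (j h i) f3 m)
  (fun i k : I => A (j h i) (A (e k) f2) m)
  (fun k i : I => A (e k) (A (j h i) f2) m)
  (fun i k : I => A (j h i) (A (j h k) f3) m) An) _.
have Eu := fund_covector s1 uE; have Ev := fund_covector s2 vE.
have Ew := fund_covector s3 wE.
have := half_schouten_algebra MP hP u v w.
rewrite /fund_tensor3 /phi_.
rewrite (jmap_ph MP hP (fund_transposeE uE)).
rewrite (jmap_ph MP hP (fund_transposeE vE)).
rewrite (fund_transposeE wE) vsprojK ?proj_g_in// => <-.
congr (_ + _ + _); apply: eq_bigr => i _; apply: eq_bigr => k _.
- by rewrite (fund_commutator (j h i) (j h k) s3) Eu Ev Ew.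
- by rewrite (fund_commutator (j h i) (e k) s2) Eu Ev Ew.
- by rewrite (fund_commutator (e i) (e k) s1) Eu Ev Ew.
Unshelve. all: by end_near. Qed.

Lemma lie_derivative_dressing h (x : subvs_of g) (m : S) (f1 f2 : S -> R^o) :
  complement DG h -> smooth_at m f1 -> smooth_at m f2 ->
  lie_derivative (xS (vsval x)) (PS h) f1 f2 m =
  - fund_tensor2 dr (F_ br B h x) m (dfun f1 m) (dfun f2 m).
Proof.
move=> hP s1 s2.
have [u uE] := covector_riesz m (dfun f1 m).
have [v vE] := covector_riesz m (dfun f2 m).
have Eu := fund_covector s1 uE; have Ev := fund_covector s2 vE.
rewrite /lie_derivative (fund_poisson h _ s1 s2).
rewrite poissonE//; last exact: smooth_at_fund.
rewrite poissonE//; last exact: smooth_at_fund.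
rewrite !opprK -!sumrN -!big_split /=.
rewrite /fund_tensor2 /F_ /jinv linfunE; last first.
  by move=> a y z; rewrite linearP; exact: B_linr MP _ a (vsval y) (vsval z).
rewrite (jmap_ph MP hP (fund_transposeE uE)).
rewrite (jmap_ph MP hP (fund_transposeE vE)).
rewrite -(lie_derivative_algebra MP hP _ _ (subvsP x)) -sumrN.
apply: eq_bigr => i _.
(* Together, the second-order terms are the commutators of x_S with the fields of e_i and of
   j(eps^i), and hence first derivatives along brackets. *)
have C1 := fund_commutator (vsval x) (e i) s1.
have C2 := fund_commutator (vsval x) (j h i) s2.
rewrite (etrans (esym (Eu _)) (esym C1)) (etrans (esym (Ev _)) (esym C2)).
rewrite -(Eu (e i)) -(Ev (j h i)).
have E (a b c d p q : R) :
  - (a * p + q * c) + b * p + q * d = - ((a - b) * p + q * (c - d)) by ring.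
exact: E.
Qed.

(** By [P_S_riesz] the two bivectors differ by (v|p_h' u - p_h u), and these two projections of [u]
    are the values of j' and j on the pulled-back covector. *)
Lemma P_S_twist h h' (m : S) (al be : covector R n) :
  complement DG h -> complement DG h' ->
  PS h' m al be = PS h m al be - fund_tensor2 dr (twist B h h') m al be.
Proof.
move=> hP hP'; have [u uE] := covector_riesz m al.
have [v vE] := covector_riesz m be.
rewrite (P_S_riesz hP uE vE) (P_S_riesz hP' uE vE) /fund_tensor2 /twist.
rewrite (jmap_ph MP hP (fund_transposeE uE)).
rewrite (jmap_ph MP hP' (fund_transposeE uE)).
rewrite (fund_transposeE vE) vsprojK; last first.
  (* Both decompositions have sum [u], so the difference of the [h]-components is one of
     [g]-components and lies in [g], as projecting to [subvs_of g] requires. *)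
  have -> : ph h' u - ph h u = proj_g g h u - proj_g g h' u.
    have pE h0 : complement DG h0 -> ph h0 u = u - proj_g g h0 u.
      by move=> hP0; rewrite -[X in X - _](proj_add hP0 u) addrC addKr.
    by rewrite (pE _ hP) (pE _ hP') opprB addrC addrA subrK.
  by rewrite rpredB ?proj_g_in.
have -> : B v (ph h' u - ph h u) = B v (ph h' u) - B v (ph h u).
  by rewrite (B_Dr MP) (B_Nr MP).
have E (a b : R) : - b = - a - (b - a) by ring.
exact: E.
Qed.


(** * Smoothness of the action, the quasi-Poisson structure and the moment map *)

Lemma smooth_action_dressing : smooth_action dr.
Proof.
split; first exact: dressing1.
  by move=> a b m _ _; exact: dressingM.
(* The action of G extends to all of D, so it is its own smooth extension. Joint continuity, which
   plots do not supply, comes from a local section. *)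
move=> a m _; exists setT, dr; split=> //; first exact: openT.
apply: smooth_map2_plot => [[b p]|V x phi psi]; last exact: plot_dressing.
have [U [sigma [oU Up [csigma _] sK]]] := qm_section p.
have c1 : {for (b, p), continuous
    (fun z : (D * S)%type => pi (mul z.1 (sigma z.2)))}.
  have [cmul _] := @lmul_smooth R _ D.
  have [cpi _] := qm_pi_smooth S.
  apply: (@continuous_comp _ _ _
    (fun z : (D * S)%type => mul z.1 (sigma z.2)) pi); last exact: cpi.
  apply: (@continuous_comp _ _ _ (fun z : (D * S)%type => (z.1, sigma z.2))
            (fun z : (D * D)%type => mul z.1 z.2)); last exact: cmul.
  apply: cvg_pair; first exact: cvg_fst.
  apply: (@continuous_comp _ _ _ snd sigma); first exact: cvg_snd.
  exact: csigma.
have N : \forall z \near (b, p), U (z : (D * S)%type).2.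
  have c2 : {for (b, p), continuous (@snd D S)} by exact: cvg_snd.
  by apply: c2; exact: open_nbhs_nbhs.
change ((fun z : (D * S)%type => dr z.1 z.2) @ (b, p) --> dr b p).
have -> : dr b p = pi (mul b (sigma p)) by rewrite -dressing_pi sK.
apply: cvg_trans c1; apply: near_eq_cvg; apply: filterS N => z Uz.
by rewrite -dressing_pi sK.
Qed.

Lemma quasi_poisson_dressing : quasi_poisson_action dr PS.
Proof.
split; first exact: smooth_action_dressing.
- move=> h hP; split.
  + move=> m a al al' be; rewrite /P_S mulrN mulr_sumr -opprD -big_split /=.
    congr (- _); apply: eq_bigr => i _.
    have E (p q b : R) : (a * p + q) * b = a * (p * b) + q * b by ring.
    by rewrite add_lfunE scale_lfunE; exact: E.
  + by move=> m al be; exact: P_S_anti.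
  + move=> U f1 f2 oU s1 s2; apply: smooth_at_fun => m Um.
    have Um' : nbhs m U by exact: open_nbhs_nbhs.
    apply: smooth_at_poisson; first exact: smooth_fun_at s1.
    exact: smooth_fun_at s2.
- move=> h hP U f1 f2 f3 oU s1 s2 s3 m Um.
  have Um' : nbhs m U by exact: open_nbhs_nbhs.
  by apply: half_schouten_dressing => //; exact: (smooth_fun_at Um').
- move=> h hP x U f1 f2 oU s1 s2 m Um.
  have Um' : nbhs m U by exact: open_nbhs_nbhs.
  by apply: lie_derivative_dressing => //; exact: (smooth_fun_at Um').
- by move=> h h' hP hP' m al be; exact: P_S_twist.
Qed.

Lemma tangent_map_id (m : S) v : tangent_map (fun s : S => s) m v = v.
Proof. exact: tderiv_coord. Qed.

Lemma pullback_id (m : S) (al : covector R n) :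
  cotangent_pullback (fun s : S => s) m al = al.
Proof.
apply/lfunP => v.
rewrite /cotangent_pullback linfunE ?tangent_map_id// => a x y.
by rewrite !tangent_map_id linearP.
Qed.

(** [hat_form] is defined by choice, so a form with the required values has to be exhibited: it is
    -(x|.) composed with the inverse [k] of the isomorphism from [h] to the tangent space, which
    admissibility provides. *)
Lemma hat_formE h (x : subvs_of g) (s : S) : complement DG h ->
  admissible_at h s ->
  forall xi, xi \in h -> hat_form h x s (xS xi s) = - B (vsval x) xi.
Proof.
move=> hP [_ hinj hsurj].
suff [al alP] : exists al : covector R n,
    forall xi, xi \in h -> al (xS xi s) = - B (vsval x) xi.
  exact: (@xgetPex _ 0 [set al : covector R n | forall xi, xi \in h ->
    al (xS xi s) = - B (vsval x) xi] (ex_intro _ al alP)).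
have ex v : exists xi, xi \in h /\ xS xi s = v.
  by have [xi xih <-] := hsurj v I; exists xi.
pose k v := xget 0 [set xi | xi \in h /\ xS xi s = v].
have kP v : k v \in h /\ xS (k v) s = v.
  have [xi xiP] := ex v.
  exact: (@xgetPex _ 0 [set xi | xi \in h /\ xS xi s = v] (ex_intro _ xi xiP)).
have kE xi : xi \in h -> k (xS xi s) = xi.
  move=> xih; have [kh kx] := kP (xS xi s).
  by apply: hinj => //; rewrite inE.
(* Injectivity on [h] gives linearity: a combination of chosen preimages is a preimage, in [h], of
   the combination. *)
have lk : linear k.
  move=> a u v; have [ku ku'] := kP u; have [kv kv'] := kP v.
  rewrite -{1}ku' -{1}kv' -fund_field_linear; apply: kE.
  by rewrite rpredD// rpredZ.
have ll : linear (fun v => - B (vsval x) (k v) : R^o).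
  move=> a u v; rewrite lk.
  apply: etrans (congr1 -%R (B_linr MP (vsval x) a (k u) (k v))) _.
  by rewrite opprD scalerN.
exists (linfun (fun v => - B (vsval x) (k v) : R^o)) => xi xih.
by rewrite linfunE// kE.
Qed.

Lemma moment_map_id : moment_map dr PS (fun s : S => s).
Proof.
split=> //.
  split=> [m _|a b]; first exact: cvg_id.
  (* In charts the identity is the transition map. *)
  by move: (chart_compat a b); rewrite setIT.
move=> Om h oOm hP adm x m Omm be.
have admm : admissible_at h m by apply: adm; exists m.
have lb : linear (fun y => be (xS y m) : R^o).
  by move=> a y z; rewrite fund_field_linear linearP.
have xE : proj_g g h (vsval x) = vsval x.
  by rewrite /proj_g daddv_pi_id ?subvsP//; have [] := hP.
rewrite pullback_id /P_S -sumrN.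
(* [x] is expanded with coefficients (x|j(eps^i)); the value of the hat form on the field of
   j(eps^i) is the opposite of this coefficient, and its sign cancels the one in [P_S]. *)
rewrite -{1}xE -(sum_e MP hP (vsval x)) (linear_sum_fun _ _ lb).
apply: eq_bigr => i _; have [jh _] := j_spec MP hP i.
have E (b c : R) : c * b = - (b * - c) by ring.
by rewrite (hat_formE x hP admm jh); exact: E.
Qed.

End Main.

Theorem mainTheorem6 (R : realType) (n : nat) (DG : group_pair R n)
    (S : quotient_manifold DG) :
  quasi_hamiltonian S (@dressing R n DG S) (@P_S R n DG S) /\
  moment_map (@dressing R n DG S) (@P_S R n DG S) (fun s : S => s).
Proof.
have mm := moment_map_id S; split=> //; split; last by exists (fun s : S => s).
exact: quasi_poisson_dressing.
Qed.
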